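(* For $i=1,2$ let $L_i=\widehat{\sigma_1^{x_i}\sigma_2^{y_i}[1,3]^{z_i}}$ with integers $x_i,y_i,z_i\ge 0$. If $V_{L_1}=V_{L_2}$, then $L_1=L_2$. Moreover, $L_1$ has a representation as $\widehat{\sigma_1^{x}\sigma_2^{y}[1,3]^{z}}$ with integers $x,y,z\ge 0$ and $z\equiv 0\pmod 3$. When $L_1$ is a torus link of braid index three, it has one of the following forms: (1) $x_1=y_1=0$ and $z_1\ge 3$, so $L_1=T(3,z_1)$; (2) $x_1=y_1=1$ and $z_1\ge 2$, so $L_1=T(3,z_1+1)$; (3) $\min(x_1,y_1)=1$, $\max(x_1,y_1)=3$, $z_1\equiv 0\pmod 3$, $z_1\ge 3$, so $L_1=T(3,z_1+2)$; (4) $\min(x_1,y_1)=2$, $\max(x_1,y_1)=4$, $z_1\equiv 2\pmod 3$, so $L_1=T(3,z_1+3)$; (5) $x_1=y_1=2$, $z_1\equiv 2\pmod 3$, so $L_1=T(3,z_1+2)$; (6) $\min(x_1,y_1)=0$, $\max(x_1,y_1)=2$, $z_1\equiv 1\pmod 3$, $z_1\ge 4$, so $L_1=T(3,z_1+1)$.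
   Context: $B_3$ is the 3-strand braid group with generators $\sigma_1,\sigma_2$; $\widehat{\beta}$ is the closure of $\beta$; $[1,3]=\sigma_1\sigma_2$. $T(3,n)$ is the torus link, the closure of $[1,3]^n$. $V_L(t)$ is the Jones polynomial of the oriented link $L$, normalized so that the unknot has $V=1$ and satisfying $t^{-1}V_{L_+}-tV_{L_-}=(t^{1/2}-t^{-1/2})V_{L_0}$; the braid generator $\sigma_i$ is a positive crossing. *)

(* Defs.v *)
From HB Require Import structures.
From mathcomp Require Import all_boot all_order all_algebra fraction.
Set Implicit Arguments. Unset Strict Implicit. Unset Printing Implicit Defensive.
Import Order.TTheory GRing.Theory Num.Theory.

(* Braid words.  A letter (i, true) is sigma_i, (i, false) is sigma_i^-1 *)
(* (i is 1-based, as in the paper).                                    *)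
Definition letter := (nat * bool)%type.
Definition word := seq letter.

Definition valid (n : nat) (w : word) : bool :=
  all (fun l : letter => (0 < l.1) && (l.1 < n)) w.

Inductive braid_eq : word -> word -> Prop :=
| be_refl w : braid_eq w w
| be_sym u v : braid_eq u v -> braid_eq v u
| be_trans u v w : braid_eq u v -> braid_eq v w -> braid_eq u w
| be_cancel u v i b : 0 < i ->
    braid_eq (u ++ [:: (i, b); (i, ~~ b)] ++ v) (u ++ v)
| be_far u v i j : 0 < i -> 0 < j -> i.+1 < j ->
    braid_eq (u ++ [:: (i, true); (j, true)] ++ v) (u ++ [:: (j, true); (i, true)] ++ v)
| be_braid u v i : 0 < i ->
    braid_eq (u ++ [:: (i, true); (i.+1, true); (i, true)] ++ v)
             (u ++ [:: (i.+1, true); (i, true); (i.+1, true)] ++ v).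

(* Isotopy of closed braids, via Markov's theorem: the equivalence relation
   on pairs (number of strands, braid word) generated by braid-group equality,
   conjugation and (positive or negative) stabilization. *)
Inductive markov : nat -> word -> nat -> word -> Prop :=
| mk_refl n w : markov n w n w
| mk_sym n u m v : markov n u m v -> markov m v n u
| mk_trans n u m v k w : markov n u m v -> markov m v k w -> markov n u k w
| mk_braid n u v : valid n u -> valid n v -> braid_eq u v -> markov n u n v
| mk_conj n u v : valid n u -> valid n v -> markov n (u ++ v) n (v ++ u)
| mk_stab n w b : 0 < n -> valid n w -> markov n w n.+1 (rcons w (n, b)).

Definition closure_eq (n : nat) (w : word) (m : nat) (w' : word) : Prop :=
  markov n w m w'.

Definition braid_index_three (w : word) : Prop :=
  forall m w', closure_eq 3 w m w' -> 3 <= m.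

(* Jones polynomial of a closed braid, via the Kauffman bracket.       *)
(* Values in the field of fractions of Z[A]; the Jones polynomial      *)
(* V(t) is obtained by A = t^{-1/4}.                                  *)
Local Open Scope ring_scope.

Definition LF := {fraction {poly int}}.
Definition varA : LF := tofrac ('X : {poly int}).
Definition loopd : LF := - varA ^+ 2 - varA ^- 2.

Section Bracket.
Variables (n : nat) (w : word).
Local Notation c := (size w).

(* For a state s (s k = true : the "identity" smoothing of crossing k,
   s k = false : the "cup-cap" smoothing e_i), the closure of the resolved
   diagram has vertices (level a, position x); crossing k lies between
   level k and level (k+1) mod c. *)
Definition cross_edge (s : {ffun 'I_c -> bool}) (k : 'I_c)
    (u v : 'I_c * 'I_n) : bool :=
  let i := (nth (0%N, true) w k).1 in
  let k' := ((k.+1) %% c)%N in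
  let vert (x y : 'I_n) := (x == y) && (s k || ((x != i.-1 :> nat) && (x != i :> nat))) in
  let cap (x y : 'I_n) := ~~ s k &&
     (((x == i.-1 :> nat) && (y == i :> nat)) || ((x == i :> nat) && (y == i.-1 :> nat))) in
  [|| (u.1 == k :> nat) && (v.1 == k' :> nat) && vert u.2 v.2,
      (v.1 == k :> nat) && (u.1 == k' :> nat) && vert v.2 u.2,
      (u.1 == k :> nat) && (v.1 == k :> nat) && cap u.2 v.2
    | (u.1 == k' :> nat) && (v.1 == k' :> nat) && cap u.2 v.2].

Definition state_edge (s : {ffun 'I_c -> bool}) : rel ('I_c * 'I_n) :=
  fun u v => [exists k, cross_edge s k u v].

Definition state_loops (s : {ffun 'I_c -> bool}) : nat :=
  n_comp (state_edge s) [pred x | true].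

Definition crossing_weight (s : {ffun 'I_c -> bool}) (k : 'I_c) : LF :=
  if (nth (0%N, true) w k).2 == s k then varA else varA^-1.

Definition bracket : LF :=
  if c == 0%N then loopd ^+ n.-1 else
  \sum_(s : {ffun 'I_c -> bool})
     (\prod_(k < c) crossing_weight s k) * loopd ^+ (state_loops s).-1.
End Bracket.

Definition writhe (w : word) : int :=
  \sum_(l <- w) (if l.2 then 1 else -1).

(* Jones polynomial of the closure of the n-braid w, as a function of
   A = t^{-1/4}:  V = (-A^3)^{-writhe} <D>. *)
Definition jones (n : nat) (w : word) : LF :=
  (- varA ^+ 3) ^ (- writhe w) * bracket n w.

(* [1,3]^z = (sigma_1 sigma_2)^z *)
Definition delta13 (z : nat) : word := flatten (nseq z [:: (1%N, true); (2%N, true)]).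

Definition fam (x y z : nat) : word :=
  nseq x (1%N, true) ++ nseq y (2%N, true) ++ delta13 z.

Definition torus3 (n : nat) : word := delta13 n.

(* Main.v *)
Require Import Defs.
From mathcomp Require Import all_boot all_order all_algebra fraction.
From mathcomp Require Import zify ring.
Set Implicit Arguments. Unset Strict Implicit. Unset Printing Implicit Defensive.
Import Order.TTheory GRing.Theory Num.Theory.

(** Loops of a Kauffman state are counted through 2-colourings: a diagram with
    [l] loops has [2 ^ l] of them, and their number is the trace of a transfer
    operator that satisfies the Temperley-Lieb relations.  These relations make
    the bracket invariant under braid moves, conjugation and stabilization, and
    on three strands they split the Temperley-Lieb algebra into a trivial and a
    2-dimensional (Burau) representation.  With [t = A^-4], [a = (-t)^x] and
    [b = (-t)^y], this gives for the closure of [s1^x s2^y (s1 s2)^(3k)]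
      [t (1 + t)^2 V = (- t^(1/2))^e (1 + 2t + 2t^2 + 2t^3 + t^4 + t^(3k+1) R)],
    where [e = x + y + 6k] and [R = t + t a b + (a + b) (1 + t + t^2)].  The
    lowest term gives [e]; the lowest degree of [R] is at most 2 unless [R = 0],
    which only happens for [{x, y} = {1, 2}], so the lowest degree of
    [t^(3k) R] gives [k], and then [a + b] and [a b] give [{x, y}].  Every
    member of the family is conjugate to one with third exponent divisible by
    3, on which the Jones polynomial is therefore a complete invariant; the
    list of torus links is the comparison of these normal forms. *)

(** * Colourings of Kauffman states *)

Section FfunInsert.
Variable T : finType.

Definition fins n (h : 'I_n.+1) (a : T) (f : {ffun 'I_n -> T}) : {ffun 'I_n.+1 -> T} :=
  [ffun i => if unlift h i is Some j then f j else a].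

Lemma fins_at n (h : 'I_n.+1) a f : fins h a f h = a.
Proof. by rewrite ffunE unlift_none. Qed.

Lemma fins_lift n (h : 'I_n.+1) a f j : fins h a f (lift h j) = f j.
Proof. by rewrite ffunE liftK. Qed.

Lemma big_fins (R : Type) (idx : R) (op : Monoid.com_law idx) n (h : 'I_n.+1)
    (G : {ffun 'I_n.+1 -> T} -> R) :
  \big[op/idx]_f G f = \big[op/idx]_a \big[op/idx]_f G (fins h a f).
Proof.
rewrite pair_big /=.
rewrite (reindex (fun p : T * {ffun 'I_n -> T} => fins h p.1 p.2)) //=.
exists (fun f => (f h, [ffun j => f (lift h j)])) => [[a f]|f] _ /=.
  congr (_, _); first by rewrite fins_at.
  by apply/ffunP=> j; rewrite ffunE fins_lift.
apply/ffunP=> i; rewrite ffunE; case: unliftP => [j ->|->] //=.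
by rewrite ffunE.
Qed.

Lemma codom_fins0 n a (f : {ffun 'I_n -> T}) : codom (fins ord0 a f) = a :: codom f.
Proof.
rewrite !codomE enum_ordSl /= fins_at -map_comp; congr (_ :: _).
by apply: eq_map => j /=; rewrite fins_lift.
Qed.

Lemma big_codomS (R : Type) (idx : R) (op : Monoid.com_law idx) n (G : seq T -> R) :
  \big[op/idx]_(f : {ffun 'I_n.+1 -> T}) G (codom f) =
  \big[op/idx]_a \big[op/idx]_(f : {ffun 'I_n -> T}) G (a :: codom f).
Proof.
rewrite (big_fins op ord0); apply: eq_bigr => a _; apply: eq_bigr => f _.
by rewrite codom_fins0.
Qed.

Lemma big_codom0 (R : Type) (idx : R) (op : Monoid.com_law idx) (G : seq T -> R) :
  \big[op/idx]_(f : {ffun 'I_0 -> T}) G (codom f) = G [::].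
Proof.
rewrite (big_pred1 (ffun0 (card_ord 0))); last first.
  by move=> f /=; apply/esym/eqP/ffunP; case.
by congr G; apply: size0nil; rewrite size_codom card_ord.
Qed.

Lemma size_codom_ord n (f : {ffun 'I_n -> T}) : size (codom f) = n.
Proof. by rewrite size_codom card_ord. Qed.

Lemma nth_codom_ord n (f : {ffun 'I_n -> T}) x0 (i : 'I_n) : nth x0 (codom f) i = f i.
Proof. by rewrite codomE (nth_map i) ?nth_ord_enum // size_enum_ord. Qed.

End FfunInsert.

(** * Transfer operators of stacked cup-caps *)

Section ColourKernel.
Variable n : nat.
Local Notation L := {ffun 'I_n -> bool}.

(** Colours are read at natural-number positions, with default [false] out of range, so that [i.-1]
    and [i] can be used without bound proofs. *)
Definition at_ (f : L) (k : nat) : bool := if insub k is Some x then f x else false.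

(** The 1-based generator index [i] acts on the 0-based positions [i.-1] and [i]; [b] colours the
    arc leaving the cup-cap below. *)
Definition upd (i : nat) (b : bool) (f : L) : L :=
  [ffun x : 'I_n => if ((x : nat) == i.-1) || ((x : nat) == i) then b else f x].

Lemma at_ord f (x : 'I_n) : at_ f x = f x.
Proof. by rewrite /at_ valK. Qed.

Lemma at_upd i b f k : k < n ->
  at_ (upd i b f) k = if (k == i.-1) || (k == i) then b else at_ f k.
Proof. by move=> kn; rewrite -[k]/(val (Ordinal kn)) !at_ord ffunE. Qed.

Lemma at_inj f g : (forall k, k < n -> at_ f k = at_ g k) -> f = g.
Proof. by move=> E; apply/ffunP=> x; rewrite -!at_ord E. Qed.

(* Counts the 2-colourings, with colours [f] on top and [h] at the bottom, of
   the strands of the cup-caps [s] stacked in order. *)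
Fixpoint ker (s : seq nat) (f h : L) : nat :=
  if s is i :: s' then
    (at_ f i.-1 == at_ f i) * \sum_(b : bool) ker s' (upd i b f) h
  else (f == h).

(** Identifying top and bottom closes the diagram, so the trace counts the 2-colourings of the
    closure. *)
Definition ztr (s : seq nat) : nat := \sum_f ker s f f.

Lemma ker_cat u v f h : ker (u ++ v) f h = \sum_g ker u f g * ker v g h.
Proof.
elim: u f => [|i u IH] f /=.
  rewrite (bigD1 f) //= eqxx mul1n big1 ?addn0 // => g ne.
  by rewrite eq_sym (negbTE ne).
under [RHS]eq_bigr do rewrite -mulnA big_distrl /=.
rewrite -big_distrr /= exchange_big /=; congr (_ * _).
by apply: eq_bigr => b _; rewrite IH.
Qed.

Lemma ztr_catC u v : ztr (u ++ v) = ztr (v ++ u).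
Proof.
rewrite /ztr; under eq_bigr do rewrite ker_cat.
rewrite exchange_big; apply: eq_bigr => f _; rewrite ker_cat.
by apply: eq_bigr => g _; rewrite mulnC.
Qed.

(** Cyclicity of the trace brings the local piece to the front, so a relation between kernels holds
    inside every closed diagram. *)
Lemma ztr_local c u v w w' : (forall f h, ker w f h = c * ker w' f h) ->
  ztr (u ++ w ++ v) = c * ztr (u ++ w' ++ v).
Proof.
move=> E; rewrite ztr_catC -catA (ztr_catC u) -catA /ztr big_distrr /=.
apply: eq_bigr => f _; rewrite !(ker_cat w) !(ker_cat w') big_distrr /=.
by apply: eq_bigr => g _; rewrite E mulnA.
Qed.

Lemma upd_idem i b c f : upd i b (upd i c f) = upd i b f.
Proof.
apply/ffunP=> x; rewrite !ffunE.
by case: (_ || _).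
Qed.

(** The factor 2 counts the colours of the circle enclosed between the two cup-caps. *)
Lemma ker_ii i f h : 0 < i < n -> ker [:: i; i] f h = 2 * ker [:: i] f h.
Proof.
case/andP=> i0 ni; have pn : i.-1 < n by apply: leq_ltn_trans (leq_pred i) ni.
rewrite /= !big_bool /= !at_upd ?eqxx ?orbT //= !upd_idem.
by rewrite !mul1n addnn -mul2n mulnCA.
Qed.

Lemma ker_far i j f h : 0 < i -> i.+1 < j -> j < n -> ker [:: i; j] f h = ker [:: j; i] f h.
Proof.
move=> i0 ij jn.
have C b c : upd j b (upd i c f) = upd i c (upd j b f).
  by apply/ffunP=> x; rewrite !ffunE; case: (boolP (_ || _)) => [/orP|//] a1; case: (boolP (_ || _)) => [/orP|//] a2; lia.
have A1 k b : (k == j.-1) || (k == j) -> at_ (upd i b f) k = at_ f k.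
  by move=> kj; rewrite at_upd; [case: ifP => //; lia|lia].
have A2 k b : (k == i.-1) || (k == i) -> at_ (upd j b f) k = at_ f k.
  by move=> kj; rewrite at_upd; [case: ifP => //; lia|lia].
rewrite /= !big_bool /= !(A1, A2) ?eqxx ?orbT // !C.
by do 2 case: eqP => _; rewrite ?mul0n ?mul1n ?muln0 ?addn0 // addnACA.
Qed.

Lemma ker_iji i j f h : 0 < i < n -> 0 < j < n -> (i == j.+1) || (j == i.+1) ->
  ker [:: i; j; i] f h = ker [:: i] f h.
Proof.
move=> i0 j0 ij.
(* [k] is the position touched by the cup-cap [j] but not by [i]. Its colour runs along the
   straightened zigzag and forces the two inner colours, leaving one sum. *)
have [k [ki kj kn]] : exists k, [/\ (k == j.-1) || (k == j), (k != i.-1) && (k != i) & k < n].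
  by case/orP: ij => /eqP ij; [exists j.-1|exists j]; split; lia.
have U a b c : at_ f k = b -> upd i a (upd j b (upd i c f)) = upd i a f.
  move=> kb; apply/ffunP=> x; rewrite !ffunE.
  case: (boolP ((x == i.-1 :> nat) || _)) => // /negbTE xi.
  by case: ifP => // xj; rewrite -kb -at_ord; congr at_; lia.
have c5 : (i.-1 == i.-1) || (i.-1 == i) by lia.
have c6 : (i == i.-1) || (i == i) by lia.
case/orP: ij => E.
- have c1 : (j.-1 == i.-1) || (j.-1 == i) = false by lia.
  have c2 : (j == i.-1) || (j == i) = true by lia.
  have c3 : (i.-1 == j.-1) || (i.-1 == j) = true by lia.
  have c4 : (i == j.-1) || (i == j) = false by lia.
  have kE : k = j.-1 by lia.
  rewrite /= !big_bool /= !at_upd; [>|lia..]; rewrite c1 c2 c3 c4 ?c5 ?c6 -kE.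
  by case E' : (at_ f k); rewrite /= ?(mul0n, mul1n, addn0, add0n) !U.
- have c1 : (j.-1 == i.-1) || (j.-1 == i) = true by lia.
  have c2 : (j == i.-1) || (j == i) = false by lia.
  have c3 : (i.-1 == j.-1) || (i.-1 == j) = false by lia.
  have c4 : (i == j.-1) || (i == j) = true by lia.
  have kE : k = j by lia.
  rewrite /= !big_bool /= !at_upd; [>|lia..]; rewrite c1 c2 c3 c4 ?c5 ?c6 -kE.
  rewrite -kE in U; case E' : (at_ f k); rewrite /= ?(mul0n, mul1n, addn0, add0n) !(U _ _ _ E') ?eqxx ?muln1 // ?mul1n ?addn0 //.
Qed.

(** The cup-cap as a 0/1 matrix between the level above and the level below, in the form in which
    the edges of a state describe it. *)
Definition tl (i : nat) : rel L := fun f g =>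
  [&& at_ f i.-1 == at_ f i, at_ g i.-1 == at_ g i
    & [forall x : 'I_n, ((x : nat) != i.-1) && ((x : nat) != i) ==> (f x == g x)]].

Lemma ker_cons i s f h : 0 < i < n -> ker (i :: s) f h = \sum_g tl i f g * ker s g h.
Proof.
move=> i0 /=; under [RHS]eq_bigr do rewrite mulnbl.
rewrite -big_mkcond /=; case: (boolP (at_ f i.-1 == at_ f i)) => E; last first.
  by rewrite mul0n big_pred0 // => g; rewrite /tl (negbTE E).
rewrite mul1n (reindex_onto (fun b => upd i b f) (fun g => at_ g i)) /=.
  apply: eq_bigl => b; rewrite /tl E !at_upd; [>|lia..].
  rewrite !eqxx ?orbT !eqxx andbT /=; apply/esym/forallP => x; apply/implyP => xi.
  by rewrite ffunE; case: ifP => //; lia.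
move=> g /and3P[_ /eqP g1 /forallP g2]; apply/ffunP=> x; rewrite ffunE; case: ifP => xi.
  by rewrite -at_ord; case/orP: xi => /eqP ->; rewrite ?g1.
by apply/eqP; move/implyP: (g2 x); apply; lia.
Qed.

Definition stp (b : bool) (i : nat) : rel L := if b then eq_op else tl i.

Fixpoint chain (ss : seq bool) (w : seq nat) (fs : seq L) (h : L) : bool :=
  match ss, w, fs with
  | b :: ss', i :: w', g :: fs' => stp b i g (head h fs') && chain ss' w' fs' h
  | _, _, _ => true
  end.

(** An identity smoothing makes consecutive levels equal and drops out of the sum, so only the
    cup-caps selected by [mask] remain. *)
Lemma chain_sum ss w f h : size ss = size w -> all (fun i => 0 < i < n) w ->
  \sum_(F : {ffun 'I_(size w) -> L}) ((head h (codom F) == f) && chain ss w (codom F) h)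
  = ker (mask (map negb ss) w) f h.
Proof.
move=> sz vw; elim: w ss sz f vw => [|i w IH] [|b ss] //= sz f vw.
  by rewrite (big_codom0 addn (fun s => ((head h s == f) && true : nat))) /= andbT eq_sym.
case/andP: vw => vi vw; case: sz => sz.
rewrite (big_codomS addn _ (fun s => ((head h s == f) && chain (b :: ss) (i :: w) s h : nat))) /=.
rewrite (bigD1 f) //= [X in _ + X]big1 ?addn0; last first.
  by move=> g /negbTE ne; rewrite big1 // => F _; rewrite ne.
rewrite eqxx /=.
transitivity (\sum_g stp b i f g * ker (mask [seq ~~ i | i <- ss] w) g h).
  under [RHS]eq_bigr => g _ do rewrite -IH // big_distrr /=.
  rewrite exchange_big /=; apply: eq_bigr => F _.
  rewrite (bigD1 (head h (codom F))) //= eqxx /= mulnb big1 ?addn0 // => g /negbTE.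
  by rewrite eq_sym => ->; rewrite muln0.
case: b => /=; last by rewrite -(ker_cons _ _ _ vi).
by rewrite (bigD1 f) //= eqxx mul1n big1 ?addn0 // => g; rewrite eq_sym => /negbTE ->.
Qed.

Lemma chainP ss w fs h : size ss = size w -> size fs = size w ->
  reflect (forall k, k < size w -> stp (nth true ss k) (nth 0 w k) (nth h fs k) (nth h fs k.+1))
          (chain ss w fs h).
Proof.
elim: ss w fs => [|b ss IH] [|i w] [|f fs] //= sz1 sz2; first exact: ReflectT.
case: sz1 sz2 => sz1 [sz2]; apply: (iffP andP).
  by move=> [H1 /(IH _ _ sz1 sz2) H2] [|k] //= kw; apply: H2.
move=> H; split; first by rewrite -nth0; apply: (H 0).
by apply/(IH _ _ sz1 sz2) => k kw; apply: (H k.+1).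
Qed.

(** The last level is compared with the first, as in the closure. The default of [head] is never
    read because [0 < c]. *)
Lemma ztr_chain c ss w : size ss = c -> size w = c -> 0 < c -> all (fun i => 0 < i < n) w ->
  ztr (mask (map negb ss) w) =
  \sum_(F : {ffun 'I_c -> L}) chain ss w (codom F) (head [ffun=> true] (codom F)).
Proof.
move=> + wc; case: _ / wc => sz w0 vw; rewrite /ztr.
under eq_bigr => f _ do rewrite -chain_sum //.
rewrite exchange_big /=; apply: eq_bigr => F _.
have hd h h' : head h (codom F) = head h' (codom F).
  by move: (size_codom_ord F); case: (codom F) => //= E; rewrite -E in w0.
rewrite (bigD1 (head [ffun=> true] (codom F))) //= big1 => [|f /negbTE ne].
  by rewrite (hd _ [ffun=> true]) eqxx addn0.
by rewrite (hd _ [ffun=> true]) eq_sym ne.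
Qed.

End ColourKernel.

(** A compatible colouring is constant on components, hence amounts to a subset of the component
    roots. *)
Lemma card_colourings (T : finType) (e : rel T) : connect_sym e ->
  #|[set p : {ffun T -> bool} | [forall x, forall y, e x y ==> (p x == p y)]]|
  = 2 ^ n_comp e [pred x | true].
Proof.
move=> sym; set S := [set p | _].
have cst p x y : p \in S -> connect e x y -> p x = p y.
  rewrite inE => /forallP pS /connectP[t et ->]; elim: t x et => //= z t IH x /andP[xz /IH <-].
  by apply/eqP; move/forallP/(_ z)/implyP: (pS x); apply.
have -> : n_comp e [pred x | true] = #|[set x | roots e x]|.
  by rewrite cardsE; apply: eq_card => x; rewrite !inE andbT.
rewrite -card_powerset.
pose g p := [set x in [set x | roots e x] | (p : {ffun T -> bool}) x].
rewrite -(@card_in_imset _ _ g S); last first.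
  move=> p q pS qS /setP E; apply/ffunP=> x.
  have rx : connect e x (fingraph.root e x) by exact: connect_root.
  rewrite (cst _ _ _ pS rx) (cst _ _ _ qS rx).
  by move: (E (fingraph.root e x)); rewrite !inE (roots_root sym).
congr #|pred_of_set _|; apply/setP=> B; rewrite powersetE; apply/imsetP/idP.
  by case=> p _ ->; apply/subsetP=> x; rewrite !inE => /andP[].
move=> sB; exists [ffun x => fingraph.root e x \in B].
  rewrite inE; apply/forallP=> x; apply/forallP=> y; apply/implyP=> exy; rewrite !ffunE.
  by have /eqP-> : fingraph.root e x == fingraph.root e y by rewrite (root_connect sym) connect1.
apply/setP=> x; rewrite !inE ffunE; apply/idP/andP.
  move=> xB; have := subsetP sB _ xB; rewrite inE => rx; split=> //.
  by move/eqP: rx => ->.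
by case=> /eqP ->.
Qed.

Lemma state_edge_sym n (w : word) (s : {ffun 'I_(size w) -> bool}) : symmetric (state_edge (n:=n) s).
Proof.
move=> u v; apply: eq_existsb => k; rewrite /cross_edge /=.
apply/idP/idP => /or4P[] H; apply/or4P;
  [exact: Or42|exact: Or41|apply: Or43|apply: Or44|exact: Or42|exact: Or41|apply: Or43|apply: Or44];
  move: H => /and3P[/andP[-> ->] -> /orP[]/andP[-> ->]]; by rewrite ?orbT.
Qed.

Lemma ztr_state_loops n (w : word) (s : {ffun 'I_(size w) -> bool}) :
  0 < size w -> valid n w ->
  ztr n (mask (map negb (codom s)) (map fst w)) = 2 ^ state_loops n s.
Proof.
move=> w0 vw.
have sym := @state_edge_sym n w s.
(* Currying turns a colouring of the vertices (level, position) into a sequence of levels;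
   compatible colourings become closed chains. *)
pose cur (p : {ffun 'I_(size w) * 'I_n -> bool}) : {ffun 'I_(size w) -> {ffun 'I_n -> bool}} :=
  [ffun k => [ffun x => p (k, x)]].
pose unc (F : {ffun 'I_(size w) -> {ffun 'I_n -> bool}}) : {ffun 'I_(size w) * 'I_n -> bool} :=
  [ffun u => F u.1 u.2].
have curK : cancel cur unc by move=> p; apply/ffunP=> -[k x]; rewrite !ffunE.
have uncK : cancel unc cur by move=> F; apply/ffunP=> k; apply/ffunP=> x; rewrite !ffunE.
rewrite -(card_colourings (sym_connect_sym sym)) -(card_imset _ (can_inj curK)).
rewrite (can2_imset_pre _ curK uncK).
rewrite (@ztr_chain n (size w)) ?size_codom_ord ?size_map //; last first.
  by move: vw; rewrite all_map.
rewrite -sum1_card [RHS]big_mkcond /=; apply: eq_bigr => F _.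
transitivity (nat_of_bool [forall x, forall y, state_edge s x y ==> (unc F x == unc F y)]);
  last by rewrite !inE.
congr nat_of_bool.
set h := head _ _.
(* The level after the last crossing wraps around: there [nth] runs off the end and returns its
   default [h], which is level 0. *)
have h0 (k : 'I_(size w)) (k' : nat) : k' = k.+1 %% size w ->
    exists2 j : 'I_(size w), (j : nat) = k' & nth h (codom F) k.+1 = F j.
  move=> ->; have lt : k.+1 %% size w < size w by rewrite ltn_mod.
  exists (Ordinal lt) => //; have [e|ne] := eqVneq k.+1 (size w).
    rewrite nth_default ?size_codom_ord ?e // /h -nth0 -(nth_codom_ord _ [ffun=> true]) /=.
    by congr nth; rewrite e modnn.
  have lt' : k.+1 < size w by rewrite ltn_neqAle ne ltn_ord.
  by rewrite -[k.+1]/(val (Ordinal lt')) nth_codom_ord; congr (F _); apply/val_inj; rewrite /= modn_small.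
have ni (k : 'I_(size w)) : nth 0 (map fst w) k = (nth (0, true) w k).1 by rewrite (nth_map (0, true)).
have vi (k : 'I_(size w)) : 0 < (nth (0, true) w k).1 < n.
  by move/(all_nthP (0, true)): vw; apply.
have A (k : 'I_(size w)) (x : 'I_n) : F k x = at_ (F k) x by rewrite at_ord.
apply/(chainP (n := n))/forallP; rewrite ?size_codom_ord ?size_map //.
- move=> H u; apply/forallP => v; apply/implyP => /existsP[k]; rewrite !ffunE.
  have [j jk Fj] := h0 k _ erefl.
  move: (H k (ltn_ord k)); rewrite !nth_codom_ord ni Fj /cross_edge -jk.
  case: (s k) => /=; rewrite ?andbF ?andbT ?orbF.
    move/eqP=> E /orP[]/andP[/andP[/eqP/val_inj -> /eqP/val_inj ->] /eqP ->];
    by rewrite E.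
  case/and3P=> /eqP c1 /eqP c2 /forallP c3.
  case/or4P=> /andP[/andP[/eqP/val_inj -> /eqP/val_inj ->]].
  + by move=> /andP[/eqP <- /(implyP (c3 _))].
  + by move=> /andP[/eqP <- /(implyP (c3 _))]; rewrite eq_sym.
  + by move=> /orP[]/andP[/eqP e1 /eqP e2]; rewrite !A e1 e2 c1.
  + by move=> /orP[]/andP[/eqP e1 /eqP e2]; rewrite !A e1 e2 c2.
move=> H k kc; set k' := Ordinal kc; rewrite -[k]/(val k').
have [j jk Fj] := h0 k' _ erefl; rewrite !nth_codom_ord ni Fj.
have E u v : cross_edge s k' u v -> F u.1 u.2 = F v.1 v.2.
  move=> ce; have := H u => /forallP/(_ v)/implyP; rewrite !ffunE => /(_ _)/eqP; apply.
  by apply/existsP; exists k'.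
have V (x : 'I_n) : s k' || ((x != (nth (0, true) w k').1.-1 :> nat) && (x != (nth (0, true) w k').1 :> nat)) ->
    F k' x = F j x.
  by move=> sx; apply: (E (k', x) (j, x)); apply/or4P; apply: Or41; rewrite /= jk !eqxx sx.
move: (vi k'); set i := (nth _ w k').1 in V *; move=> /andP[i0 iN].
have pN : i.-1 < n by lia.
case sk: (s k'); rewrite /=.
  by apply/eqP/ffunP=> x; apply: V; rewrite sk.
apply/and3P; split.
- rewrite -[i.-1]/(val (Ordinal pN)) -[i in _ == at_ _ i]/(val (Ordinal iN)) !at_ord; apply/eqP.
  by apply: (E (k', _) (k', _)); apply/or4P; apply: Or43; rewrite /= sk -/i !eqxx.
- rewrite -[i.-1]/(val (Ordinal pN)) -[i in _ == at_ _ i]/(val (Ordinal iN)) !at_ord; apply/eqP.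
  by apply: (E (j, _) (j, _)); apply/or4P; apply: Or44; rewrite /= sk jk -/i !eqxx.
- by apply/forallP=> x; apply/implyP=> xi; apply/eqP; apply: V; rewrite xi orbT.
Qed.

(** * Adding a strand, and loop numbers *)

Local Notation vstate n := (all (fun i : nat => 0 < i < n)).

Section AddStrand.
Variable n : nat.
Implicit Types (f g : {ffun 'I_n -> bool}) (b c : bool).

Notation ext b f := (fins (@ord_max n) b f).

Lemma at_ext_lt f b k : k < n -> at_ (ext b f) k = at_ f k.
Proof.
move=> kn; have E : (lift ord_max (Ordinal kn) : nat) = k by rewrite lift_max.
by rewrite -{1}E at_ord fins_lift -at_ord.
Qed.

Lemma at_ext_max f b : at_ (ext b f) n = b.
Proof. by rewrite -[n in at_ _ n]/(val (@ord_max n)) at_ord fins_at. Qed.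

Definition updlast b f : {ffun 'I_n -> bool} :=
  [ffun x : 'I_n => if (x : nat) == n.-1 then b else f x].

Lemma upd_ext i b c f : 0 < i < n -> upd i b (ext c f) = ext c (upd i b f).
Proof.
move=> i0; apply: at_inj => k; rewrite ltnS leq_eqVlt => /orP[/eqP ->|kn].
  by rewrite at_upd ?at_ext_max //; case: ifP => //; lia.
by rewrite at_upd ?at_ext_lt ?at_upd //; lia.
Qed.

Lemma upd_ext_max b c f : upd n b (ext c f) = ext b (updlast b f).
Proof.
apply: at_inj => k; rewrite ltnS leq_eqVlt => /orP[/eqP ->|kn].
  by rewrite at_upd // eqxx orbT at_ext_max.
rewrite at_upd ?(leqW kn) // !at_ext_lt //.
rewrite -[k in RHS]/(val (Ordinal kn)) at_ord ffunE /= -at_ord /=.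
have -> : (k == n) = false by lia.
by rewrite orbF.

Qed.

Lemma ker_ext s f g b c : vstate n s -> ker s (ext b f) (ext c g) = (b == c) * ker s f g.
Proof.
elim: s f => [|i s IH] f /= => [_|/andP[i0 vs]].
  rewrite mulnb; congr nat_of_bool; apply/eqP/andP => [E|[/eqP -> /eqP -> //]].
  split; first by rewrite -(at_ext_max f b) E at_ext_max.
  by apply/eqP/at_inj => k kn; rewrite -(at_ext_lt f b kn) E at_ext_lt.
rewrite !at_ext_lt; [>|lia..]; rewrite mulnCA [X in _ = _ * X]big_distrr /=; congr (_ * _).
by apply: eq_bigr => a _; rewrite upd_ext ?IH.
Qed.

Lemma ztrS s : vstate n s -> ztr n.+1 s = 2 * ztr n s.
Proof.
move=> vs; rewrite /ztr (big_fins _ ord_max) big_bool /= mul2n -addnn.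
by congr addn; apply: eq_bigr => f _; rewrite ker_ext // eqxx mul1n.
Qed.

(** Closing the new strand through a single cup-cap only bends it: its two colours are forced by its
    neighbour, and [updlast] writes the same colour back. *)
Lemma ztr_rcons s : 0 < n -> vstate n s -> ztr n.+1 (rcons s n) = ztr n s.
Proof.
move=> n0 vs; rewrite -cats1 ztr_catC /= /ztr (big_fins _ ord_max) exchange_big /=.
apply: eq_bigr => f _; rewrite !big_bool !at_ext_max !upd_ext_max !at_ext_lt ?ker_ext //; [>|lia..].
have E : updlast (at_ f n.-1) f = f.
  apply/ffunP=> x; rewrite ffunE; case: eqP => // <-; exact: at_ord.
by case: (at_ f n.-1) E => E; rewrite /= !(mul0n, mul1n, addn0, add0n) E.
Qed.

Lemma ztr_nil : ztr n [::] = 2 ^ n.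
Proof.
rewrite /ztr /=; under eq_bigr do rewrite eqxx.
by rewrite sum1_card card_ffun card_bool card_ord.
Qed.

End AddStrand.

(** Loop number of a bare list of cup-caps, read off the colouring count, which is a power of 2. *)
Definition loops n s := trunc_log 2 (ztr n s).

Lemma loops_state n (w : word) (s : {ffun 'I_(size w) -> bool}) :
  0 < size w -> valid n w ->
  loops n (mask (map negb (codom s)) (map fst w)) = state_loops n s.
Proof. by move=> w0 vw; rewrite /loops ztr_state_loops // trunc_expnK. Qed.

(** A nonempty list is realized as the state of a positive word in which every crossing gets the
    cup-cap smoothing. *)
Lemma ztr_loops n s : vstate n s -> ztr n s = 2 ^ loops n s.
Proof.
case: s => [|i s] vs; first by rewrite /loops ztr_nil trunc_expnK.
pose w : word := map (pair^~ true) (i :: s).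
have vw : valid n w by rewrite /valid all_map.
have [] : 0 < size w /\ valid n w by [].
move=> w0 _; have := ztr_state_loops [ffun=> false] w0 vw.
have -> : map fst w = i :: s by rewrite -map_comp map_id_in.
have -> : mask (map negb (codom ([ffun=> false] : {ffun 'I_(size w) -> bool}))) (i :: s) = i :: s.
  have -> : map negb (codom ([ffun=> false] : {ffun 'I_(size w) -> bool})) = nseq (size w) true.
    rewrite codomE -map_comp -[X in nseq X](size_enum_ord (size w)).
    by elim: (enum _) => //= j e ->; rewrite ffunE.
  by rewrite mask_true // size_map.
by move=> E; rewrite /loops E trunc_expnK.
Qed.

Lemma loops_nil n : loops n [::] = n.
Proof. by rewrite /loops ztr_nil trunc_expnK. Qed.

Lemma loops_catC n u v : loops n (u ++ v) = loops n (v ++ u).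
Proof. by rewrite /loops ztr_catC. Qed.

Lemma loopsS n s : vstate n s -> loops n.+1 s = (loops n s).+1.
Proof. by move=> vs; rewrite /loops ztrS // ztr_loops // -expnS !trunc_expnK. Qed.

Lemma loops_rcons n s : 0 < n -> vstate n s -> loops n.+1 (rcons s n) = loops n s.
Proof. by move=> n0 vs; rewrite /loops ztr_rcons. Qed.

Lemma loops_ii n u v i : vstate n (u ++ v) -> 0 < i < n ->
  loops n (u ++ [:: i; i] ++ v) = (loops n (u ++ i :: v)).+1.
Proof.
rewrite all_cat => /andP[vu vv] i0.
rewrite /loops (ztr_local _ _ (fun f h => ker_ii f h i0)) ztr_loops -?expnS ?trunc_expnK //.
by rewrite all_cat vu /= i0.
Qed.

Lemma loops_far n u v i j : 0 < i -> i.+1 < j -> j < n ->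
  loops n (u ++ [:: i; j] ++ v) = loops n (u ++ [:: j; i] ++ v).
Proof.
move=> i0 ij jn; rewrite /loops (@ztr_local n 1 _ _ _ [:: j; i]) ?mul1n // => f h.
by rewrite mul1n ker_far.
Qed.

Lemma loops_iji n u v i j : 0 < i < n -> 0 < j < n -> (i == j.+1) || (j == i.+1) ->
  loops n (u ++ [:: i; j; i] ++ v) = loops n (u ++ i :: v).
Proof.
move=> i0 j0 ij; rewrite /loops (@ztr_local n 1 _ _ _ [:: i]) ?mul1n // => f h.
by rewrite mul1n (ker_iji _ _ i0).
Qed.

(** Ensures that the exponent [(state_loops s).-1] of the bracket is an honest difference. *)
Lemma state_loops_gt0 n (w : word) (s : {ffun 'I_(size w) -> bool}) :
  0 < n -> 0 < size w -> 0 < state_loops n s.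
Proof.
move=> n0 w0; apply/card_gt0P.
have sym := @state_edge_sym n w s.
exists (fingraph.root (state_edge (n:=n) s) (Ordinal w0, Ordinal n0)).
by rewrite !inE andbT; exact: (roots_root (sym_connect_sym sym)).
Qed.

Local Open Scope ring_scope.

(** * Markov invariance of the bracket *)

Section KauffmanState.
Variables (F : fieldType) (A : F).
Hypothesis A0 : A != 0.

Definition loopval : F := - A ^+ 2 - A ^- 2.
Local Notation d := loopval.
Hypothesis d0 : d != 0.

Definition wt (b : bool) : F := if b then A else A^-1.

(** The Kauffman state sum by recursion on the word. A general functional [phi] of the remaining
    cup-caps lets local relations be checked in any context. *)
Fixpoint bsum (w : word) (phi : seq nat -> F) : F :=
  if w is l :: w' then
    wt l.2 * bsum w' phi + wt (~~ l.2) * bsum w' (fun s => phi (l.1 :: s))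
  else phi [::].

Lemma eq_bsum n w phi psi : valid n w -> (forall s, vstate n s -> phi s = psi s) ->
  bsum w phi = bsum w psi.
Proof.
elim: w phi psi => [|[i b] w IH] phi psi /=; first by move=> _; apply.
move=> /andP[i0 vw] E; congr (_ * _ + _ * _); first exact: IH.
by apply: IH => // s vs; apply: E; rewrite /= i0.
Qed.

Lemma eq_bsumT w phi psi : phi =1 psi -> bsum w phi = bsum w psi.
Proof.
elim: w phi psi => [|[i b] w IH] phi psi E /=; first exact: E.
by congr (_ * _ + _ * _); apply: IH => // s.
Qed.

Lemma bsumD w phi psi c c' :
  bsum w (fun s => c * phi s + c' * psi s) = c * bsum w phi + c' * bsum w psi.
Proof. by elim: w phi psi => //= -[i b] w IH phi psi; rewrite !IH; ring. Qed.

Lemma bsumZ w phi c : bsum w (fun s => c * phi s) = c * bsum w phi.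
Proof. by elim: w phi => //= -[i b] w IH phi; rewrite !IH; ring. Qed.

Lemma bsum_cat u v phi : bsum (u ++ v) phi = bsum u (fun s => bsum v (fun t => phi (s ++ t))).
Proof. by elim: u phi => //= -[i b] u IH phi; rewrite !IH. Qed.

Lemma bsum_exchange u v (phi : seq nat -> seq nat -> F) :
  bsum u (fun s => bsum v (fun t => phi s t)) = bsum v (fun t => bsum u (fun s => phi s t)).
Proof. by elim: u phi => //= -[i b] u IH phi; rewrite !IH bsumD. Qed.

Definition loopw n s : F := d ^+ loops n s.

(** With [d ^+ loops] instead of one power less, this is [d] times the Jones polynomial, and no
    predecessor occurs. *)
Definition jd n w : F := (- A ^+ 3) ^ (- writhe w) * bsum w (loopw n).

Lemma writhe_cat u v : writhe (u ++ v) = writhe u + writhe v.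
Proof. by rewrite /writhe big_cat. Qed.

Lemma A3_neq0 : - A ^+ 3 != 0.
Proof. by rewrite oppr_eq0 expf_neq0 // A0. Qed.

Lemma jd_catC n u v : jd n (u ++ v) = jd n (v ++ u).
Proof.
rewrite /jd !writhe_cat addrC; congr (_ * _); rewrite !bsum_cat bsum_exchange.
by apply: eq_bsumT => s; apply: eq_bsumT => t; rewrite /loopw loops_catC.
Qed.

Lemma jd_local n u v m m' : valid n u -> valid n v -> writhe m = writhe m' ->
  (forall s t, vstate n s -> vstate n t ->
    bsum m (fun r => loopw n (s ++ r ++ t)) = bsum m' (fun r => loopw n (s ++ r ++ t))) ->
  jd n (u ++ m ++ v) = jd n (u ++ m' ++ v).
Proof.
move=> vu vv wm E; rewrite /jd !writhe_cat wm; congr (_ * _).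
rewrite !bsum_cat; apply: (eq_bsum vu) => s vs.
rewrite !bsum_cat [LHS]bsum_exchange [RHS]bsum_exchange; apply: (eq_bsum vv) => t vt.
exact: E.
Qed.

(** Second Reidemeister move: the smoothings that leave a cup-cap have total weight
    [A ^+ 2 + A ^- 2 + d = 0]. *)
Lemma jd_cancel n u v i b : valid n u -> valid n v -> (0 < i < n)%N ->
  jd n (u ++ [:: (i, b); (i, ~~ b)] ++ v) = jd n (u ++ v).
Proof.
move=> vu vv i0; rewrite -[in RHS](cat0s v).
apply: jd_local => // [|s t vs vt]; first by rewrite /writhe !big_cons !big_nil; case: b.
rewrite /= /loopw loops_ii // ?all_cat ?vs // exprS negbK.
move: (d ^+ loops n (s ++ t)) (d ^+ loops n (s ++ i :: t)) => X Y.
by case: b; rewrite /wt /= /loopval; field; exact: A0.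
Qed.

Lemma jd_far n u v i j : valid n u -> valid n v -> (0 < i)%N -> (i.+1 < j < n)%N ->
  jd n (u ++ [:: (i, true); (j, true)] ++ v) = jd n (u ++ [:: (j, true); (i, true)] ++ v).
Proof.
move=> vu vv i0 /andP[ij jn].
apply: jd_local => // [|s t vs vt]; first by rewrite /writhe !big_cons !big_nil.
by rewrite /= /loopw (loops_far s t i0 ij jn) /=;
move: (d ^+ _) (d ^+ _) (d ^+ _) (d ^+ _) => X Y Z T; ring.
Qed.

(** Third Reidemeister move: once [e_i e_i] and [e_i e_j e_i] are reduced, both sides have the same
    coefficient on each of the five remaining diagrams. *)
Lemma jd_braid n u v i : valid n u -> valid n v -> (0 < i)%N -> (i.+1 < n)%N ->
  jd n (u ++ [:: (i, true); (i.+1, true); (i, true)] ++ v) =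
  jd n (u ++ [:: (i.+1, true); (i, true); (i.+1, true)] ++ v).
Proof.
move=> vu vv i0 iN.
apply: jd_local => // [|s t vs vt]; first by rewrite /writhe !big_cons !big_nil.
have I : (0 < i < n)%N by lia.
have J : (0 < i.+1 < n)%N by lia.
have st : vstate n (s ++ t) by rewrite all_cat vs.
rewrite /= /loopw !loops_ii // !loops_iji ?eqxx ?orbT // !exprS.
move: (d ^+ loops n (s ++ t)) (d ^+ loops n (s ++ i :: t)) (d ^+ loops n (s ++ i.+1 :: t)) => X Y Z.
move: (d ^+ loops n (s ++ [:: i; i.+1] ++ t)) (d ^+ loops n (s ++ [:: i.+1; i] ++ t)) => U V.
by rewrite /wt /= /loopval; field; exact: A0.
Qed.

Lemma jdS n w : valid n w -> jd n.+1 w = d * jd n w.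
Proof.
move=> vw; rewrite /jd mulrCA -(bsumZ _ _ d); congr (_ * _).
by apply: (eq_bsum vw) => s vs; rewrite /loopw loopsS // exprS.
Qed.

Lemma valid_leq n m w : (n <= m)%N -> valid n w -> valid m w.
Proof. by move=> nm; apply: sub_all => l /andP[-> /= ln]; apply: leq_trans nm. Qed.

Lemma jdD n m w : valid n w -> jd (m + n) w = d ^+ m * jd n w.
Proof.
move=> vw; elim: m => [|m IH]; first by rewrite mul1r.
by rewrite addSn jdS ?IH ?exprS ?mulrA //; apply: valid_leq vw; apply: leq_addl.
Qed.

(** A positive kink contributes [A * d + A^-1 = - A ^+ 3], a negative one the inverse; the writhe
    factor cancels it. *)
Lemma jd_stab n w b : (0 < n)%N -> valid n w -> jd n.+1 (rcons w (n, b)) = jd n w.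
Proof.
move=> n0 vw; rewrite /jd -cats1 writhe_cat bsum_cat.
rewrite (eq_bsum vw (psi := fun s => (wt b * d + wt (~~ b)) * loopw n s)); last first.
  by move=> s vs; rewrite /= cats0 cats1 /loopw loops_rcons // loopsS // exprS; move: (d ^+ _) (wt b) (wt _) => X Y Z; ring.
rewrite bsumZ mulrA; congr (_ * _).
rewrite opprD expfzDr ?A3_neq0 // -mulrA -[RHS]mulr1; congr (_ * _).
rewrite /writhe big_seq1; case: b; rewrite /wt /= /loopval ?opprK ?expr1z.
  by rewrite exprN1; field; rewrite A0 A3_neq0.
by field; exact: A0.
Qed.

(* [braid_eq] neither preserves the number of strands nor excludes the spurious
   letters of index 0 in intermediate words: the latter are erased, and the
   invariant is compared on sufficiently many strands. *)
Definition posletters : word -> word := filter (fun l : letter => 0 < l.1)%N.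

Lemma valid_bound w : exists N, valid N (posletters w).
Proof.
exists (\max_(l <- w) l.1).+1; apply/allP => l; rewrite mem_filter => /andP[-> lw] /=.
by rewrite ltnS; apply: (@leq_bigmax_seq _ w xpredT (fun l => l.1)).
Qed.

Lemma jd_braid_eq u v : braid_eq u v ->
  exists N0, forall N, (N0 <= N)%N -> jd N (posletters u) = jd N (posletters v).
Proof.
have B a b k : exists N0, forall N, (N0 <= N)%N ->
    [/\ valid N (posletters a), valid N (posletters b) & (k < N)%N].
  have [Na Ha] := valid_bound a; have [Nb Hb] := valid_bound b.
  exists (Na + Nb + k.+1)%N => N NN; split; [apply: valid_leq Ha|apply: valid_leq Hb|]; lia.
have FC := filter_cat (fun l : letter => (0 < l.1)%N).
elim=> {u v}.
- by move=> w; exists 0%N.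
- by move=> u v _ [N0 H]; exists N0 => N /H.
- move=> u v w _ [N0 H] _ [N1 H1]; exists (N0 + N1)%N => N NN.
  by rewrite H ?H1 //; lia.
- move=> u v i b i0; have [N0 H] := B u v i; exists N0 => N /H[vu vv iN].
  by rewrite /posletters !FC /= i0; apply: jd_cancel => //; rewrite i0.
- move=> u v i j i0 j0 ij; have [N0 H] := B u v j; exists N0 => N /H[vu vv jN].
  by rewrite /posletters !FC /= i0 j0; apply: jd_far => //; rewrite ij.
- move=> u v i i0; have [N0 H] := B u v i.+1; exists N0 => N /H[vu vv jN].
  by rewrite /posletters !FC /= i0; apply: jd_braid.
Qed.

Lemma posletters_valid n w : valid n w -> posletters w = w.
Proof. by move=> vw; apply/all_filterP; apply: sub_all vw => l /andP[]. Qed.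

Theorem jd_markov n u m v : markov n u m v -> jd n u = jd m v.
Proof.
elim=> {n u m v} //.
- by move=> n u m v k w _ -> _ ->.
- move=> n u v vu vv /jd_braid_eq[N0]; rewrite (posletters_valid vu) (posletters_valid vv).
  (* The words agree on enough strands; each extra strand contributes a factor [d] to both sides,
     which cancels. *)
  move=> /(_ (N0 + n)%N (leq_addr _ _)); rewrite !jdD // => /mulfI; apply.
  by rewrite expf_neq0 // d0.
- by move=> n u v _ _; exact: jd_catC.
- by move=> n w b n0 vw; rewrite jd_stab.
Qed.

End KauffmanState.

(** * The Jones polynomial as a value of the Markov invariant *)

Lemma varA_neq0 : varA != 0.
Proof. by rewrite /varA tofrac_eq0 polyX_eq0. Qed.

Lemma loopval_neq0 (F : fieldType) (A : F) : A != 0 -> A ^+ 4 + 1 != 0 -> loopval A != 0.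
Proof.
move=> A0 A4; have -> : loopval A = - (A ^+ 4 + 1) * A ^- 2 by rewrite /loopval; field.
by rewrite mulf_neq0 ?oppr_eq0 // invr_eq0 expf_neq0.
Qed.

Lemma loopd_neq0 : loopd != 0.
Proof.
apply: loopval_neq0 varA_neq0 _.
rewrite /varA -tofracXn -tofrac1 -tofracD tofrac_eq0.
apply/eqP => /(congr1 (fun p : {poly int} => p`_0)).
by rewrite coefD coefXn coef1 coef0.
Qed.

Lemma bsum_states w phi :
  \sum_(s : {ffun 'I_(size w) -> bool})
     (\prod_(k < size w) crossing_weight s k) * phi (mask (map negb (codom s)) (map fst w))
  = bsum varA w phi.
Proof.
(* The weight is rewritten in terms of the list of smoothings, so that the sum over states can
   follow the recursion of [bsum]. *)
pose W (w : word) ss := \prod_(p <- zip w ss) wt varA (p.1.2 == p.2).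
transitivity (\sum_(s : {ffun 'I_(size w) -> bool})
    (W w (codom s) * phi (mask (map negb (codom s)) (map fst w)))).
  apply: eq_bigr => s _; congr (_ * _); rewrite /W (big_nth ((0%N, true), true)).
  rewrite size_zip size_codom_ord minnn big_mkord; apply: eq_bigr => k _.
  by rewrite nth_zip ?size_codom_ord //= nth_codom_ord.
elim: w phi => [|[i b] w IH] phi /=.
  by rewrite (big_codom0 +%R (fun c => W [::] c * phi (mask (map negb c) [::]))) /= /W big_nil mul1r.
rewrite (big_codomS +%R _ (fun c => W ((i, b) :: w) c * phi (mask (map negb c) (i :: map fst w)))).
rewrite big_bool /= -!IH !mulr_sumr; congr (_ + _); apply: eq_bigr => s _;
  by rewrite /W /= big_cons /= mulrA; case: (b).
Qed.

Lemma jonesE n w : (0 < n)%N -> valid n w -> loopd * jones n w = jd varA n w.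
Proof.
move=> n0 vw; rewrite /jones /jd mulrCA; congr (_ * _).
rewrite /bracket; case: eqP => [/size0nil ->|/eqP].
  by rewrite /= /loopw loops_nil -exprS prednK.
rewrite -lt0n => w0; rewrite -bsum_states mulr_sumr; apply: eq_bigr => s _.
by rewrite mulrCA -exprS prednK ?state_loops_gt0 // /loopw loops_state.
Qed.

(** * The trace formula on three strands *)

Section TwoByTwo.
Variable R : comNzRingType.

Definition mx2 (a b c d : R) : 'M[R]_2 :=
  \matrix_(i, j) if i == 0 then (if j == 0 then a else b) else (if j == 0 then c else d).

Lemma mulmx2 a b c d a' b' c' d' :
  mx2 a b c d * mx2 a' b' c' d' =
  mx2 (a * a' + b * c') (a * b' + b * d') (c * a' + d * c') (c * b' + d * d').
Proof.
apply/matrixP => i j; rewrite !mxE !big_ord_recl big_ord0 !mxE /= addr0.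
by case: (i == 0); case: (j == 0).
Qed.

Lemma addmx2 a b c d a' b' c' d' :
  mx2 a b c d + mx2 a' b' c' d' = mx2 (a + a') (b + b') (c + c') (d + d').
Proof. by apply/matrixP => i j; rewrite !mxE; case: (i == 0); case: (j == 0). Qed.

Lemma scalemx2 e a b c d : e *: mx2 a b c d = mx2 (e * a) (e * b) (e * c) (e * d).
Proof. by apply/matrixP => i j; rewrite !mxE; case: (i == 0); case: (j == 0). Qed.

Lemma mx2_1 : mx2 1 0 0 1 = 1.
Proof.
by apply/matrixP => i j; rewrite !mxE; case: i j => [[|[|i]] Hi] [[|[|j]] Hj].
Qed.

Lemma mxtrace_mx2 a b c d : \tr (mx2 a b c d) = a + d.
Proof. by rewrite /mxtrace !big_ord_recl big_ord0 !mxE /= addr0. Qed.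

End TwoByTwo.

Section ThreeStrands.
Variables (F : fieldType) (A : F).
Hypothesis A0 : A != 0.
Local Notation d := (loopval A).

(** The 2-dimensional representation of the 3-strand Temperley-Lieb algebra with loop value [d]. *)
Definition tlmx (i : nat) : 'M[F]_2 :=
  if i == 1%N then mx2 d 1 0 0 else mx2 0 0 1 d.

Definition tlprod (s : seq nat) : 'M[F]_2 := \prod_(i <- s) tlmx i.

Lemma tlprod_cat u v : tlprod (u ++ v) = tlprod u * tlprod v.
Proof. exact: big_cat. Qed.

Lemma tlmx_ii i : tlmx i * tlmx i = d *: tlmx i.
Proof. by rewrite /tlmx; case: eqP => _; rewrite mulmx2 scalemx2; congr mx2; ring. Qed.

Lemma tlmx_iji i j : (0 < i < 3)%N -> (0 < j < 3)%N -> i != j ->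
  tlmx i * tlmx j * tlmx i = tlmx i.
Proof.
case: i j => [|[|[|i]]] // [|[|[|j]]] // _ _ _; rewrite /tlmx /= !mulmx2; congr mx2; ring.
Qed.

(** The loop functional is a combination of two traces: the 2-dimensional representation and, with
    weight [d ^+ 2 - 2], the trivial one, which kills both generators. The relations [ii] and [iji]
    shrink any word to length at most two. *)
Lemma loopw_trace s : vstate 3 s ->
  loopw A 3 s = d * (\tr (tlprod s) + (d ^+ 2 - 2%:R) * (s == [::])%:R).
Proof.
have H1 : loops 2 [:: 1%N] = 1%N by rewrite (@loops_rcons 1 [::]) ?loops_nil.
(* Doubling a letter multiplies both sides by [d]. *)
have dbl u i v : vstate 3 (u ++ i :: v) ->
    loopw A 3 (u ++ i :: v) = d * (\tr (tlprod (u ++ i :: v)) + (d ^+ 2 - 2%:R) * (u ++ i :: v == [::])%:R) ->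
    loopw A 3 (u ++ [:: i; i] ++ v) = d * (\tr (tlprod (u ++ [:: i; i] ++ v)) + (d ^+ 2 - 2%:R) * (u ++ [:: i; i] ++ v == [::])%:R).
  rewrite all_cat /= => /and3P[vu vi vv] E.
  rewrite /loopw loops_ii ?all_cat ?vu // exprS -/(loopw A _ _) E; congr (_ * _).
  have nn w j : (u ++ j :: w == [::]) = false by case: (u).
  rewrite !nn !mulr0 !addr0 -linearZ /=; congr (\tr _).
  rewrite !tlprod_cat /tlprod !big_cons [tlmx i * (tlmx i * _)]mulrA tlmx_ii.
  by rewrite scalerAr scalerAl.
move: {2}(size s).+1 (ltnSn (size s)) => m; elim: m s => // m IH [|i [|j s]].
- by move=> _ _; rewrite /loopw loops_nil /tlprod big_nil mxtrace1 eqxx mulr1n mulr1 addrC subrK -exprS.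
- move=> _ /andP[vi _]; rewrite /= mulr0 addr0 /tlprod big_seq1 /loopw.
  have -> : loops 3 [:: i] = 2%N.
    case: i vi => [|[|[|i]]] // _; first by rewrite loopsS ?H1.
    by rewrite (@loops_rcons 2 [::]) ?loops_nil.
  by rewrite /tlmx; case: eqP => _; rewrite mxtrace_mx2; ring.
have [<-{j}|ij] := eqVneq i j.
  by move=> sz /andP[vi vs]; apply: (dbl [::]) => //; apply: IH.
case: s => [|k s] sz /and3P[vi vj].
  move=> _; rewrite /= mulr0 addr0 /tlprod !big_cons big_nil mulr1 /loopw.
  have -> : loops 3 [:: i; j] = 1%N.
    case: i j vi vj ij {sz} => [|[|[|i]]] // [|[|[|j]]] // _ _ _.
      by rewrite (@loops_rcons 2 [:: 1%N]).
    by rewrite (@loops_catC 3 [:: 2%N]) (@loops_rcons 2 [:: 1%N]).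
  by rewrite /tlmx; case: i j vi vj ij {sz} => [|[|[|i]]] // [|[|[|j]]] // _ _ _;
     rewrite mulmx2 mxtrace_mx2; ring.
move=> /= /andP[vk vs]; have [<-|jk] := eqVneq j k.
  by apply: (dbl [:: i]) => /=; rewrite ?vi ?vj //; apply: IH => //=; rewrite vi vj.
have <- : i = k by move: ij jk vi vj vk; lia.
rewrite /loopw (@loops_iji 3 [::] s i j) //; last by move: ij vi vj; lia.
rewrite -/(loopw A _ _) IH //=; [|by move: sz => /=; lia|by rewrite vi].
by rewrite /tlprod !big_cons !mulrA tlmx_iji.
Qed.

Definition crossmx (l : letter) : 'M[F]_2 := wt A l.2 *: 1 + wt A (~~ l.2) *: tlmx l.1.

Lemma bsum_trace w : valid 3 w ->
  bsum A w (loopw A 3) =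
  d * (\tr (\prod_(l <- w) crossmx l) + (d ^+ 2 - 2%:R) * \prod_(l <- w) wt A l.2).
Proof.
move=> vw; rewrite (eq_bsum A vw loopw_trace) bsumZ; congr (_ * _).
rewrite (eq_bsumT A _ (psi := fun s => 1 * \tr (1 * tlprod s) + (d ^+ 2 - 2%:R) * (s == [::])%:R)); last first.
  by move=> s; rewrite !mul1r.
rewrite bsumD mul1r; congr (_ + _ * _).
  (* The left factor [P] collects the matrices already read, which makes the induction go
     through. *)
  suff H P : bsum A w (fun s => \tr (P * tlprod s)) = \tr (P * \prod_(l <- w) crossmx l).
    by rewrite H mul1r.
  elim: w {vw} => [|[i b] w IH] in P *; first by rewrite /= /tlprod !big_nil.
  rewrite big_cons mulrA -IH /= -bsumD; apply: eq_bsumT => s /=.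
  rewrite /crossmx /= /tlprod big_cons mulrDr mulrDl linearD /= mulrA.
  by rewrite -!scalerAr -!scalerAl !mxtraceZ mulr1.
elim: w {vw} => [|[i b] w IH]; first by rewrite /= big_nil.
rewrite big_cons /= IH (eq_bsumT A _ (psi := fun s => 0 * 0)) ?bsumZ ?mul0r ?mulr0 ?addr0 //.
Qed.

End ThreeStrands.

(** The term [R] of the overview, and next its numerator, over any ring so that morphisms can carry
    identities from [LF] to polynomials. *)
Definition burau_sum (R : comNzRingType) (t : R) (x y : nat) : R :=
  t + t * ((- t) ^+ x * (- t) ^+ y) + ((- t) ^+ x + (- t) ^+ y) * (1 + t + t ^+ 2).

Definition jones_num (R : comNzRingType) (t : R) (x y k : nat) : R :=
  1 + 2%:R * t + 2%:R * t ^+ 2 + 2%:R * t ^+ 3 + t ^+ 4 + t ^+ (3 * k).+1 * burau_sum t x y.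

Section FamilyTrace.
Variables (F : fieldType) (A : F).
Hypothesis A0 : A != 0.
Local Notation d := (loopval A).
Local Notation t := (A ^- 4).
Local Notation S1 := (crossmx A (1%N, true)).
Local Notation S2 := (crossmx A (2%N, true)).

Lemma crossmx1E : S1 = mx2 (- t * A) A^-1 0 A.
Proof.
rewrite /crossmx /tlmx /wt /= -mx2_1 !scalemx2 addmx2 /loopval.
by congr mx2; field.
Qed.

Lemma crossmx2E : S2 = mx2 A 0 A^-1 (- t * A).
Proof.
rewrite /crossmx /tlmx /wt /= -mx2_1 !scalemx2 addmx2 /loopval.
by congr mx2; field.
Qed.

(** The crossing matrices are triangular with eigenvalues [- t * A] and [A]. The off-diagonal entry
    is a geometric sum, given through its product with [1 + t] to avoid a division. *)
Lemma crossmx_pow x : exists2 be, (1 + t) * be = A ^- 2 * (A ^+ x * (1 - (- t) ^+ x)) &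
  S1 ^+ x = mx2 ((- t) ^+ x * A ^+ x) be 0 (A ^+ x) /\
  S2 ^+ x = mx2 (A ^+ x) 0 be ((- t) ^+ x * A ^+ x).
Proof.
elim: x => [|x [be Hbe [E1 E2]]].
  by exists 0; rewrite ?expr0 -?mx2_1 ?mul1r ?subrr ?mulr0.
exists (A^-1 * A ^+ x + (- t * A) * be); last first.
  rewrite !(exprS S1) !(exprS S2) E1 E2 crossmx1E crossmx2E !mulmx2 !exprS.
  by split; congr mx2; ring.
rewrite mulrDr [_ * (_ * A * be)]mulrCA Hbe !exprS.
by move: ((- t) ^+ x) (A ^+ x) => a X; field.
Qed.

(** The full twist acts as a scalar, so it enters the trace only through a power of [A ^- 6]. *)
Lemma crossmx_delta : (S1 * S2) ^+ 3 = A ^- 6 *: 1.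
Proof.
rewrite !exprS expr0 mulr1 crossmx1E crossmx2E !mulmx2 -mx2_1 scalemx2.
by congr mx2; field.
Qed.

Lemma fam_prod x y k :
  \prod_(l <- fam x y (3 * k)) crossmx A l = A ^- 6 ^+ k *: (S1 ^+ x * S2 ^+ y).
Proof.
have N n l : \prod_(j <- nseq n l) crossmx A j = crossmx A l ^+ n.
  by rewrite big_nseq; elim: n => //= n ->; rewrite exprS.
have D z : \prod_(l <- delta13 z) crossmx A l = (S1 * S2) ^+ z.
  elim: z => [|z IH]; first by rewrite /delta13 big_nil.
  by rewrite /delta13 /= !big_cons -/(delta13 z) IH exprS mulrA.
rewrite /fam !big_cat !N D exprM crossmx_delta exprZn expr1n /=.
by rewrite mulrA -scalerAr mulr1.
Qed.

Lemma fam_size x y k : size (fam x y (3 * k)) = (x + y + 6 * k)%N.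
Proof.
have D z : size (delta13 z) = (2 * z)%N by elim: z => // z IH; rewrite /delta13 /= -/(delta13 z) IH; lia.
by rewrite /fam !size_cat !size_nseq D; lia.
Qed.

Definition positive (w : word) := all (fun l : letter => l.2) w.

Lemma positive_writhe w : positive w -> writhe w = (size w)%:Z.
Proof.
elim: w => [|[i b] w IH] /=; first by rewrite /writhe big_nil.
by case/andP => -> /IH; rewrite /writhe big_cons => -> /=; lia.
Qed.

Lemma positive_wt w : positive w -> \prod_(l <- w) wt A l.2 = A ^+ size w.
Proof.
elim: w => [|[i b] w IH] /=; first by rewrite big_nil.
by case/andP => -> /IH; rewrite big_cons exprS => ->.
Qed.

Lemma delta13_all (P : pred letter) z : P (1%N, true) -> P (2%N, true) -> all P (delta13 z).
Proof. by move=> P1 P2; elim: z => // z IH; rewrite /delta13 /= P1 P2. Qed.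

Lemma fam_all (P : pred letter) x y z : P (1%N, true) -> P (2%N, true) -> all P (fam x y z).
Proof. by move=> P1 P2; rewrite !all_cat !all_nseq P1 P2 !orbT delta13_all. Qed.

Lemma fam_valid x y z : valid 3 (fam x y z).
Proof. exact: fam_all. Qed.

(** The factor [(1 + t) ^+ 2] clears the off-diagonal entries and [t] clears
    [d ^+ 2 - 2 = t^-1 + t]; the base [- A ^- 2] is [- t^(1/2)]. *)
Lemma fam_jd x y k :
  jd A 3 (fam x y (3 * k)) * (t * (1 + t) ^+ 2) =
  d * ((- A ^- 2) ^+ (x + y + 6 * k) * jones_num t x y k).
Proof.
have pos : positive (fam x y (3 * k)) by apply: fam_all.
rewrite /jd bsum_trace ?fam_valid // fam_prod positive_wt // positive_writhe // fam_size.
have [be Hb [E1 _]] := crossmx_pow x; have [be' Hb' [_ E2]] := crossmx_pow y.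
rewrite mxtraceZ E1 E2 mulmx2 mxtrace_mx2.
rewrite [_ ^ _ * (d * _)]mulrCA -[LHS]mulrA; congr (_ * _).
set e := (x + y + 6 * k)%N.
have -> : (- A ^+ 3) ^ (- e%:Z) = (- A ^- 2) ^+ e * A^-1 ^+ e.
  rewrite -exprnN -exprVn -exprMn; congr (_ ^+ _).
  by field; rewrite A0 oppr_eq0 expf_neq0.
rewrite -!mulrA; congr (_ * _).
have EX : A ^+ e = A ^+ x * A ^+ y * (A ^+ k) ^+ 6 by rewrite /e mulnC 2!exprD exprM.
have ET : t ^+ (3 * k).+1 = t * (A ^+ k) ^- 12.
  rewrite exprS; congr (_ * _); rewrite exprVn -!exprM; congr (_ ^- _); lia.
have EK : A ^- 6 ^+ k = (A ^+ k) ^- 6 by rewrite exprVn -!exprM mulnC.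
rewrite /jones_num ET EK exprVn EX /burau_sum.
have [X0 Y0 K0] : [/\ A ^+ x != 0, A ^+ y != 0 & A ^+ k != 0] by rewrite !expf_neq0.
move: (A ^+ x) (A ^+ y) (A ^+ k) ((- t) ^+ x) ((- t) ^+ y) Hb Hb' X0 Y0 K0 => X Y K a b Hb Hb' X0 Y0 K0.
(* Regrouped so that [be] and [be'] occur only multiplied by [1 + t], where their values are
   known. *)
transitivity ((X * Y) ^-1 * K ^- 6 * t * (K ^- 6 * ((a + b) * X * Y * (1 + t) ^+ 2
   + ((1 + t) * be) * ((1 + t) * be')) + (d ^+ 2 - 2%:R) * (X * Y * K ^+ 6) * (1 + t) ^+ 2)).
  by field; rewrite X0 Y0 K0 A0.
rewrite Hb Hb' /loopval.
by field; rewrite X0 Y0 K0 A0.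
Qed.
End FamilyTrace.

(** * Recovering the exponents from the Jones polynomial *)

Lemma rmorph_burau_sum (R R' : comNzRingType) (f : {rmorphism R -> R'}) t x y :
  f (burau_sum t x y) = burau_sum (f t) x y.
Proof. by rewrite /burau_sum !(rmorphD, rmorphM, rmorphXn, rmorphN, rmorph1). Qed.

Lemma rmorph_jones_num (R R' : comNzRingType) (f : {rmorphism R -> R'}) t x y k :
  f (jones_num t x y k) = jones_num (f t) x y k.
Proof.
by rewrite /jones_num !(rmorphD, rmorphM, rmorphXn, rmorphN, rmorph1, rmorph_nat, rmorph_burau_sum).
Qed.

Section Evaluation.
Variables (D : idomainType) (m : nat).
Local Notation K := {fraction {poly D}}.
Local Notation X := (tofrac ('X : {poly D})).

Definition evX (z : K) (p : {poly D}) : K := (map_poly (@tofrac {poly D} \o @polyC D) p).[z].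

(** [X ^- m] is transcendental over the constants, so an identity between fractions in this element
    is one between polynomials. *)
Lemma evX_inj : (0 < m)%N -> injective (evX (X ^- m)).
Proof.
move=> m0 p q /eqP; rewrite -subr_eq0 -[_ - _](raddfB (horner_eval _)) -raddfB.
rewrite /horner_eval => /eqP E; apply/eqP; rewrite -subr_eq0; apply/eqP.
move: (p - q) E => {p q} r E; apply/polyP => i; rewrite coef0.
have [ri|ri] := leqP (size r) i; first by rewrite nth_default.
(* Clearing denominators by [X ^+ (m * size r)] reverses [r] and spreads its coefficients over
   distinct multiples of [m]. *)
pose Q : {poly D} := \sum_(j < size r) r`_j *: 'X^(m * (size r - j)).
have Q0 : Q = 0.
  apply/eqP; rewrite -tofrac_eq0; apply/eqP.
  have X0 : X != 0 by rewrite tofrac_eq0 polyX_eq0.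
  have <- : (map_poly (@tofrac {poly D} \o @polyC D) r).[X ^- m] * X ^+ (m * size r) = tofrac Q.
    rewrite horner_coef size_map_poly_id0; last by rewrite /= tofrac_eq0 polyC_eq0 lead_coef_eq0 -size_poly_gt0; lia.
    rewrite mulr_suml /Q raddf_sum; apply: eq_bigr => j _.
    rewrite coef_map /= -mul_polyC rmorphM rmorphXn -mulrA; congr (_ * _).
    rewrite exprVn -exprM.
    have -> : (m * size r = m * (size r - j) + m * j)%N by rewrite -mulnDr subnK // ltnW.
    by rewrite exprD mulrC mulfK ?expf_neq0.
  by rewrite (E : (map_poly _ r).[_] = 0) mul0r.
have := congr1 (fun P : {poly D} => P`_(m * (size r - i))) Q0.
rewrite coef0 /Q coef_sum (bigD1 (Ordinal ri)) //= big1 ?addr0.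
  by rewrite coefZ coefXn eqxx mulr1.
move=> j ne; rewrite coefZ coefXn; case: eqP => [e|_]; last by rewrite mulr0.
case/eqP: ne; apply/val_inj => /=; move/eqP: e; rewrite eqn_pmul2l // => /eqP.
by move: ri (ltn_ord j); lia.
Qed.

End Evaluation.

Section LowestTerm.
Variable D : idomainType.
Implicit Types G H : {poly D}.

Lemma lowest_degree i j G H : G.[0] != 0 -> H.[0] != 0 -> 'X^i * G = 'X^j * H -> i = j.
Proof.
wlog ij : i j G H / (i <= j)%N.
  move=> W G0 H0 E; have [|/ltnW] := leqP i j => ij; first exact: W E.
  by apply/esym; exact: W (esym E).
have X0 : 'X^i != 0 :> {poly D} by rewrite expf_neq0 ?polyX_eq0.
move=> G0 H0; rewrite -(subnKC ij) exprD -mulrA => /(mulfI X0) E.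
case: (j - i)%N E => [|k] E; first by rewrite addn0.
by move: G0; rewrite E exprS -mulrA hornerM hornerX mul0r eqxx.
Qed.

End LowestTerm.

Section BurauOrder.
Local Notation Rf := (burau_sum ('X : {poly int})).

(** The degenerate pair: the numerator no longer sees [k], which must then come from the exponent
    [e] alone. *)
Lemma burau_sum12 : Rf 1 2 = 0.
Proof. by rewrite /burau_sum; ring. Qed.

(* Multiplying by a power of ['X^3], as the full twist does, preserves the
   residue mod 3 of the lowest degree, which is [l < 3] here. *)
Lemma burau_sum_order x y : (x <= y)%N -> (x, y) <> (1%N, 2%N) ->
  exists l G, [/\ (l < 3)%N, G.[0] != 0 & Rf x y = 'X^l * G].
Proof.
rewrite /burau_sum; case: x => [|[|x]].
- case: y => [|y] _ _.
    exists 0%N, (2%:R + 4%:R * 'X + 2%:R * 'X ^+ 2); split => //; last by ring.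
    by rewrite !hornerE.
  exists 0%N, ((1 + 'X) ^+ 2 * (1 + (- 'X) ^+ y.+1)); split => //; last by rewrite exprS; ring.
  by rewrite !hornerE exprS oppr0 mul0r addr0.
- case: y => [|[|[|y]]] // _ _.
    exists 1%N, (- (1 + 'X) ^+ 2); split => //; last by ring.
    by rewrite !hornerE.
  exists 2%N, (- ((1 + 'X) * (1 - (- 'X) ^+ y.+1))); split => //; last by rewrite !exprS; ring.
  by rewrite !hornerE exprS oppr0 mul0r.
case: y => [|[|y]] // _ _.
exists 1%N, (1 + (- 'X) ^+ (x + y).+4 - ((- 'X) ^+ x.+1 + (- 'X) ^+ y.+1) * (1 + 'X + 'X ^+ 2)).
split => //; last by rewrite !exprS exprD; ring.
by rewrite !hornerE !exprS oppr0 !mul0r.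
Qed.

End BurauOrder.

Lemma expNX_inj : injective (fun x => (- 'X) ^+ x : {poly int}).
Proof.
move=> x y /= E; have N z : ((- 1) ^+ z : {poly int}).[0] != 0.
  by rewrite -[-1]polyCN -polyC_exp hornerC signr_eq0.
by apply: (lowest_degree (N x) (N y)); rewrite ![_ * (-1) ^+ _]mulrC -!exprNn.
Qed.

Lemma burau_sum_inj x y x' y' : (x <= y)%N -> (x' <= y')%N -> (x + y = x' + y')%N ->
  burau_sum ('X : {poly int}) x y = burau_sum 'X x' y' -> x = x' /\ y = y'.
Proof.
move=> xy xy' S; rewrite /burau_sum -!exprD S => /addrI.
have Q0 : 1 + 'X + 'X ^+ 2 != 0 :> {poly int}.
  by apply/eqP => /(congr1 (horner^~ 0)); rewrite !hornerE.
move/(mulIf Q0) => E.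
(* Equal sums and equal products: [(- 'X) ^+ x] is a root of the quadratic whose roots are the
   powers for [x'] and [y']. *)
have : ((- 'X) ^+ x - (- 'X) ^+ x') * ((- 'X) ^+ x - (- 'X) ^+ y') = 0 :> {poly int}.
  have P : (- 'X) ^+ x * (- 'X) ^+ y = (- 'X) ^+ x' * (- 'X) ^+ y' :> {poly int} by rewrite -!exprD S.
  move: E P; move: ((- 'X) ^+ x) ((- 'X) ^+ y) ((- 'X) ^+ x') ((- 'X) ^+ y') => a b a' b' E P.
  have -> : (a - a') * (a - b') = a * a - a * (a' + b') + a' * b' by ring.
  by rewrite -E -P; ring.
move/eqP; rewrite mulf_eq0 !subr_eq0 => /orP[]/eqP/expNX_inj Ex; lia.
Qed.

Lemma jones_num_inj x y k x' y' k' : (x <= y)%N -> (x' <= y')%N ->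
  (x + y + 6 * k = x' + y' + 6 * k')%N ->
  jones_num ('X : {poly int}) x y k = jones_num 'X x' y' k' ->
  [/\ x = x', y = y' & k = k'].
Proof.
move=> xy xy' Se /addrI E.
have X0 n : 'X^n != 0 :> {poly int} by rewrite expf_neq0 ?polyX_eq0.
have nz l (G : {poly int}) : G.[0] != 0 -> 'X^l * G != 0.
  by move=> G0; rewrite mulf_neq0 //; apply: contraNneq G0 => ->; rewrite horner0.
case: (eqVneq (x, y) (1%N, 2%N)) => [[? ?]|/eqP ne]; last have [l [G [l3 G0 RE]]] := burau_sum_order xy ne;
(case: (eqVneq (x', y') (1%N, 2%N)) => [[? ?]|/eqP ne']; last have [l' [G' [l3' G0' RE']]] := burau_sum_order xy' ne').
- by subst; split => //; lia.
- by subst; move: E (nz l' G' G0'); rewrite burau_sum12 mulr0 RE' => /esym/eqP;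
  rewrite mulf_eq0 (negbTE (X0 _)) /= => ->.
- by subst; move: E (nz l G G0); rewrite burau_sum12 mulr0 RE => /eqP;
  rewrite mulf_eq0 (negbTE (X0 _)) /= => ->.
(* The lowest degrees give [3k + 1 + l = 3k' + 1 + l'] with [l, l' < 3]. *)
have kk : k = k'.
  move: E; rewrite RE RE' !mulrA -!exprD => /(lowest_degree G0 G0'); lia.
subst k'; move/(mulfI (X0 _)): E => E.
by have [] := burau_sum_inj xy xy' _ E; [lia|].
Qed.

Lemma jones_fam_inj x y k x' y' k' : (x <= y)%N -> (x' <= y')%N ->
  jones 3 (fam x y (3 * k)) = jones 3 (fam x' y' (3 * k')) ->
  [/\ x = x', y = y' & k = k'].
Proof.
move=> xy xy' J.
set e := (x + y + 6 * k)%N; set e' := (x' + y' + 6 * k')%N.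
have E : (- varA ^- 2) ^+ e * jones_num (varA ^- 4) x y k =
         (- varA ^- 2) ^+ e' * jones_num (varA ^- 4) x' y' k'.
  apply: (mulfI loopd_neq0); rewrite -[LHS](fam_jd varA_neq0) -[RHS](fam_jd varA_neq0).
  by rewrite -!jonesE ?fam_valid // J.
pose f m : {rmorphism {poly int} -> LF} :=
  (horner_eval (varA ^- m) \o map_poly (@tofrac {poly int} \o @polyC int)).
have fX m : f m 'X = varA ^- m by rewrite /f /= map_polyX /horner_eval hornerX.
have f_inj m : (0 < m)%N -> injective (f m) by exact: evX_inj.
(* Here ['X] stands for [A ^- 2 = t^(1/2)], which makes the odd powers polynomial. Both numerators
   have constant term 1, so the lowest degrees give [e = e']. *)
have Ep : (- 'X) ^+ e * jones_num ('X ^+ 2 : {poly int}) x y k =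
          (- 'X) ^+ e' * jones_num ('X ^+ 2) x' y' k'.
  apply: (f_inj 2%N) => //; rewrite !rmorphM !rmorphXn !rmorphN !rmorph_jones_num !rmorphXn fX.
  by rewrite exprVn -exprM.
have num0 a b c : (jones_num ('X ^+ 2 : {poly int}) a b c).[0] = 1.
  rewrite -[_.[0]]/(horner_eval 0 _) rmorph_jones_num rmorphXn /= /horner_eval hornerX.
  by rewrite /jones_num !exprS !mul0r !mulr0 !addr0.
have ee : e = e'.
  have N z a b c : ((-1) ^+ z * jones_num ('X ^+ 2 : {poly int}) a b c).[0] != 0.
    by rewrite hornerM num0 mulr1 -[-1]polyCN -polyC_exp hornerC signr_eq0.
  apply: (lowest_degree (N e x y k) (N e' x' y' k')).
  by rewrite !mulrA ![_ * (-1) ^+ _]mulrC -!exprNn.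
(* With the common power cancelled only [t = A ^- 4] is left, and ['X] now stands for it. *)
apply: (jones_num_inj xy xy' ee); apply: (f_inj 4%N) => //.
rewrite !rmorph_jones_num fX; move: E; rewrite ee => /mulfI; apply.
by rewrite expf_neq0 // oppr_eq0 invr_eq0 expf_neq0 ?varA_neq0.
Qed.

Local Close Scope ring_scope.

(** * Normal forms of the closed braids *)

Lemma braid_eq_cat p q u v : braid_eq u v -> braid_eq (p ++ u ++ q) (p ++ v ++ q).
Proof.
elim=> {u v}.
- by move=> w; exact: be_refl.
- by move=> u v _; exact: be_sym.
- by move=> u v w _ Huv _; exact: be_trans.
- by move=> u v i b i0; have := be_cancel (p ++ u) (v ++ q) b i0; rewrite -!catA.
- by move=> u v i j i0 j0 ij; have := be_far (p ++ u) (v ++ q) i0 j0 ij; rewrite -!catA.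
- by move=> u v i i0; have := be_braid (p ++ u) (v ++ q) i0; rewrite -!catA.
Qed.

Lemma braid_eq_catl p u v : braid_eq u v -> braid_eq (p ++ u) (p ++ v).
Proof. by move=> /(braid_eq_cat p [::]); rewrite !cats0. Qed.

Lemma braid_eq_catr q u v : braid_eq u v -> braid_eq (u ++ q) (v ++ q).
Proof. exact: (braid_eq_cat [::]). Qed.

Local Notation s1 := (1, true).
Local Notation s2 := (2, true).
(** Garside's half twist: conjugation by it exchanges the two generators, and its square is the full
    twist. *)
Local Notation halftwist := [:: s1; s2; s1].

Lemma braid_s121 : braid_eq [:: s1; s2; s1] [:: s2; s1; s2].
Proof. exact: (be_braid [::] [::]). Qed.

Lemma halftwist_s1 : braid_eq (s1 :: halftwist) (halftwist ++ [:: s2]).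
Proof. exact: (braid_eq_catl [:: s1] braid_s121). Qed.

Lemma halftwist_s2 : braid_eq (s2 :: halftwist) (halftwist ++ [:: s1]).
Proof. exact/be_sym/(braid_eq_catr [:: s1] braid_s121). Qed.

Lemma braid_eq_nseq l l' w n : braid_eq (l :: w) (w ++ [:: l']) ->
  braid_eq (nseq n l ++ w) (w ++ nseq n l').
Proof.
move=> E; elim: n => [|n IH]; first by rewrite cats0; exact: be_refl.
apply: be_trans (braid_eq_catl [:: l] IH) _.
by have := braid_eq_catr (nseq n l') E; rewrite -catA.
Qed.

Lemma nseq2_s12 y : braid_eq (nseq y s2 ++ [:: s1; s2]) ([:: s1; s2] ++ nseq y s1).
Proof. by apply: braid_eq_nseq; apply: be_sym braid_s121. Qed.

Lemma delta13_3 : braid_eq (delta13 3) (halftwist ++ halftwist).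
Proof. exact/(braid_eq_catl halftwist)/be_sym/braid_s121. Qed.

Lemma delta13D m n : delta13 (m + n) = delta13 m ++ delta13 n.
Proof. by rewrite /delta13 nseqD flatten_cat. Qed.

Local Notation posw := (all (fun l : letter => (l == s1) || (l == s2))).

(** The full twist is two half twists, so a generator passing it is exchanged twice. *)
Lemma delta13_central w k : posw w ->
  braid_eq (w ++ delta13 (3 * k)) (delta13 (3 * k) ++ w).
Proof.
have C l : (l == s1) || (l == s2) -> braid_eq (l :: delta13 3) (delta13 3 ++ [:: l]).
  have T a b : braid_eq (a :: halftwist) (halftwist ++ [:: b]) ->
      braid_eq (b :: halftwist) (halftwist ++ [:: a]) ->
      braid_eq (a :: delta13 3) (delta13 3 ++ [:: a]).
    move=> E1 E2; apply: be_trans (braid_eq_catl [:: a] delta13_3) _.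
    apply: be_trans (be_sym (braid_eq_catr [:: a] delta13_3)).
    apply: be_trans (braid_eq_catr halftwist E1) _.
    by rewrite -!catA; exact: braid_eq_catl.
  by case/orP=> /eqP ->; [apply: T halftwist_s1 halftwist_s2|apply: T halftwist_s2 halftwist_s1].
have C' l : (l == s1) || (l == s2) -> braid_eq (l :: delta13 (3 * k)) (delta13 (3 * k) ++ [:: l]).
  move=> hl; elim: k => [|k IH]; first exact: be_refl.
  rewrite mulnS delta13D; apply: be_trans (braid_eq_catr _ (C l hl)) _.
  by rewrite -!catA; exact: (braid_eq_catl (delta13 3) IH).
elim: w => [_|l w IH /= /andP[hl /IH E]]; first by rewrite cats0; exact: be_refl.
apply: be_trans (braid_eq_catl [:: l] E) _.
by have := braid_eq_catr w (C' l hl); rewrite -catA.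
Qed.

Lemma posw_valid w : posw w -> valid 3 w.
Proof. by apply: sub_all => l /orP[]/eqP ->. Qed.

Local Notation cl u v := (closure_eq 3 u 3 v).

Lemma cl_braid u v : posw u -> posw v -> braid_eq u v -> cl u v.
Proof. by move=> /posw_valid vu /posw_valid vv; exact: mk_braid. Qed.

Lemma cl_rot u v : posw u -> posw v -> cl (u ++ v) (v ++ u).
Proof. by move=> /posw_valid vu /posw_valid vv; exact: mk_conj. Qed.

Lemma cl_rot_twist u v k : posw u -> posw v ->
  cl (u ++ v ++ delta13 (3 * k)) (v ++ u ++ delta13 (3 * k)).
Proof.
move=> pu pv; have pd z : posw (delta13 z) by exact: delta13_all.
apply: mk_trans (cl_rot pu _) _; first by rewrite all_cat pv pd.
apply: cl_braid; rewrite ?all_cat ?pu ?pv ?pd // -catA.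
by apply/braid_eq_catl/be_sym/delta13_central.
Qed.

Lemma posw_fam x y z : posw (fam x y z).
Proof. exact: fam_all. Qed.

Lemma posw_nseq l n : (l == s1) || (l == s2) -> posw (nseq n l).
Proof. by rewrite all_nseq => ->; rewrite orbT. Qed.

(** Conjugation by the half twist, with explicit inverse [hi]: [halftwist ++ hi] is inserted at the
    end and the first factor rotated away. *)
Lemma cl_halftwist w w' : valid 3 w -> valid 3 w' ->
  braid_eq (w ++ halftwist) (halftwist ++ w') -> cl w w'.
Proof.
move=> vw vw' E; pose hi : word := [:: (1, false); (2, false); (1, false)].
have K : braid_eq (halftwist ++ hi) [::].
  apply: be_trans (be_cancel [:: s1; s2] [:: (2, false); (1, false)] true (isT : 0 < 1)) _.
  apply: be_trans (be_cancel [:: s1] [:: (1, false)] true (isT : 0 < 2)) _.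
  exact: (be_cancel [::] [::] true (isT : 0 < 1)).
have K' : braid_eq (hi ++ halftwist) [::].
  apply: be_trans (be_cancel [:: (1, false); (2, false)] [:: s2; s1] false (isT : 0 < 1)) _.
  apply: be_trans (be_cancel [:: (1, false)] [:: s1] false (isT : 0 < 2)) _.
  exact: (be_cancel [::] [::] false (isT : 0 < 1)).
apply: (@mk_trans _ _ 3 (halftwist ++ (w' ++ hi))).
  apply: mk_braid => //; first by rewrite /valid !all_cat /= [all _ _]vw'.
  have := braid_eq_catr hi E; rewrite -!catA; apply: be_trans.
  by have := be_sym (braid_eq_catl w K); rewrite cats0.
apply: mk_trans (mk_conj _ _) _ => //; first by rewrite /valid all_cat [all _ _]vw'.
apply: mk_braid => //; first by rewrite /valid !all_cat /= [all _ _]vw'.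
by have := braid_eq_catl w' K'; rewrite cats0 catA.
Qed.

Lemma cl_fam_swap x y k : cl (fam x y (3 * k)) (fam y x (3 * k)).
Proof.
have pd z : posw (delta13 z) by exact: delta13_all.
apply: (@mk_trans _ _ 3 (nseq x s2 ++ nseq y s1 ++ delta13 (3 * k))); last first.
  by apply: cl_rot_twist; exact: posw_nseq.
apply: cl_halftwist; rewrite ?fam_valid //.
  by apply: posw_valid; rewrite !all_cat ?posw_nseq ?pd.
rewrite /fam -!catA.
apply: be_trans (braid_eq_catl _ (braid_eq_catl _ (be_sym (delta13_central _ _)))) _ => //.
rewrite !catA; apply: braid_eq_catr; rewrite -!catA.
apply: be_trans (braid_eq_catl _ (braid_eq_nseq y halftwist_s2)) _.
by rewrite !catA; apply: braid_eq_catr; exact: braid_eq_nseq halftwist_s1.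
Qed.

(** Passing [s1 s2] turns [s2^y] into [s1^y], which then rotates to the front past the central
    twist. *)
Lemma cl_fam_mod1 x y k : cl (fam x y (3 * k).+1) (fam (x + y).+1 1 (3 * k)).
Proof.
set D := delta13 (3 * k).
apply: (@mk_trans _ _ 3 ((nseq x s1 ++ [:: s1; s2]) ++ nseq y s1 ++ D)).
  apply: cl_braid; rewrite ?posw_fam //.
    by rewrite !all_cat ?posw_nseq ?delta13_all.
  rewrite /fam -!catA; apply: braid_eq_catl.
  by have := braid_eq_catr D (nseq2_s12 y); rewrite -catA.
apply: mk_trans (cl_rot_twist _ _ _) _; rewrite ?all_cat ?posw_nseq //.
suff -> : nseq y s1 ++ (nseq x s1 ++ [:: s1; s2]) ++ D = fam (x + y).+1 1 (3 * k) by exact: mk_refl.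
have -> : (x + y).+1 = y + (x + 1) by lia.
by rewrite /fam !nseqD -!catA.
Qed.

Lemma cl_fam_mod2 x y k : cl (fam x.+1 y.+1 (3 * k).+2) (fam x y (3 * k.+1)).
Proof.
set D := delta13 (3 * k).
have pd : posw D by exact: delta13_all.
apply: (@mk_trans _ _ 3 ([:: s1] ++ (nseq x s1 ++ nseq y s2 ++ [:: s2; s1; s2; s1; s2]) ++ D)).
  suff -> : fam x.+1 y.+1 (3 * k).+2 =
    [:: s1] ++ (nseq x s1 ++ nseq y s2 ++ [:: s2; s1; s2; s1; s2]) ++ D by exact: mk_refl.
  by rewrite /fam -(addn1 y) nseqD -!catA.
apply: mk_trans (cl_rot_twist _ _ _) _; rewrite ?all_cat ?posw_nseq //.
apply: cl_braid; rewrite ?posw_fam ?all_cat ?posw_nseq //.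
rewrite /fam mulnS delta13D -/D -!catA; do 2 apply: braid_eq_catl.
(* The rotated [s1] completes [(s2 s1)^3], another spelling of the full twist. *)
apply: (@braid_eq_catr D [:: s2; s1; s2; s1; s2; s1] [:: s1; s2; s1; s2; s1; s2]).
apply: be_trans (be_sym (braid_eq_catr halftwist braid_s121)) _.
exact: (braid_eq_catl halftwist braid_s121).
Qed.

(** Without an [s1] in front no further full twist is completed; instead braid relations and
    rotations gather all letters but one into powers of [s1]. *)
Lemma cl_fam_mod2_0y y k : cl (fam 0 y (3 * k).+2) (fam (y + 3) 1 (3 * k)).
Proof.
set D := delta13 (3 * k).
have pd : posw D by exact: delta13_all.
pose N n := nseq n s1.
have pN n : posw (N n) by exact: posw_nseq.
apply: (@mk_trans _ _ 3 (([:: s1; s2] ++ N y ++ [:: s1]) ++ [:: s2] ++ D)).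
  apply: cl_braid; rewrite ?posw_fam ?all_cat ?pN //.
  by have := braid_eq_catr ([:: s1; s2] ++ D) (nseq2_s12 y); rewrite -!catA.
apply: mk_trans (cl_rot_twist _ _ _) _; rewrite ?all_cat ?pN //.
apply: (@mk_trans _ _ 3 ([:: s1; s2] ++ ([:: s1] ++ N y ++ [:: s1]) ++ D)).
  apply: cl_braid; rewrite ?all_cat ?pN //.
  rewrite -!catA; exact/be_sym/(braid_eq_catr (N y ++ [:: s1] ++ D) braid_s121).
apply: mk_trans (cl_rot_twist _ _ _) _; rewrite ?all_cat ?pN //.
suff -> : ([:: s1] ++ N y ++ [:: s1]) ++ [:: s1; s2] ++ D = fam (y + 3) 1 (3 * k) by exact: mk_refl.
have -> : y + 3 = 1 + (y + 2) by lia.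
by rewrite /fam !nseqD -!catA.
Qed.

Lemma cl_fam_mod2_x0 x k : cl (fam x 0 (3 * k).+2) (fam (x + 3) 1 (3 * k)).
Proof.
set D := delta13 (3 * k).
have pd : posw D by exact: delta13_all.
pose N n := nseq n s1.
have pN n : posw (N n) by exact: posw_nseq.
apply: (@mk_trans _ _ 3 ((N (x + 2) ++ [:: s2]) ++ [:: s1] ++ D)).
  apply: cl_braid; rewrite ?posw_fam ?all_cat ?pN //.
  rewrite /N nseqD -!catA; apply: braid_eq_catl.
  exact/be_sym/(braid_eq_cat [:: s1] D braid_s121).
apply: mk_trans (cl_rot_twist _ _ _) _; rewrite ?all_cat ?pN //.
suff -> : [:: s1] ++ (N (x + 2) ++ [:: s2]) ++ D = fam (x + 3) 1 (3 * k) by exact: mk_refl.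
have -> : x + 3 = 1 + (x + 2) by lia.
by rewrite /fam nseqD -!catA.
Qed.

(** Exponents of the conjugate with third exponent divisible by 3. For [z] congruent to 2 and both
    exponents positive, one letter of each kind is absorbed into a new full twist. *)
Definition nf_x x y z := if z %% 3 == 0 then x else if z %% 3 == 1 then (x + y).+1
  else if (0 < x) && (0 < y) then x.-1 else x + y + 3.
Definition nf_y x y z := if z %% 3 == 0 then y else if z %% 3 == 1 then 1
  else if (0 < x) && (0 < y) then y.-1 else 1.
Definition nf_k x y z := if (z %% 3 == 2) && (0 < x) && (0 < y) then (z %/ 3).+1 else z %/ 3.

Lemma cl_nf x y z : cl (fam x y z) (fam (nf_x x y z) (nf_y x y z) (3 * nf_k x y z)).
Proof.
rewrite /nf_x /nf_y /nf_k {1}(divn_eq z 3) mulnC.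
have : z %% 3 < 3 by rewrite ltn_mod.
case: (z %% 3) => [|[|[|r]]] //= _; rewrite ?addn0 ?addn1 ?addn2.
- exact: mk_refl.
- exact: cl_fam_mod1.
case: x y => [|x] [|y] /=; rewrite ?addn0.
- exact: cl_fam_mod2_0y.
- exact: cl_fam_mod2_0y.
- exact: cl_fam_mod2_x0.
- exact: cl_fam_mod2.
Qed.

(** The closure does not see the order of the two exponents, so sorting them makes the form
    canonical. *)
Lemma cl_nf_sorted x y z : cl (fam x y z)
  (fam (minn (nf_x x y z) (nf_y x y z)) (maxn (nf_x x y z) (nf_y x y z)) (3 * nf_k x y z)).
Proof.
apply: mk_trans (cl_nf x y z) _.
case: (leqP (nf_x x y z) (nf_y x y z)) => _; [exact: mk_refl|exact: cl_fam_swap].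
Qed.

Definition same_nf x y z x' y' z' :=
  [/\ minn (nf_x x y z) (nf_y x y z) = minn (nf_x x' y' z') (nf_y x' y' z'),
      maxn (nf_x x y z) (nf_y x y z) = maxn (nf_x x' y' z') (nf_y x' y' z')
    & nf_k x y z = nf_k x' y' z'].

Lemma cl_jones w w' : posw w -> posw w' -> cl w w' -> jones 3 w = jones 3 w'.
Proof.
move=> /posw_valid vw /posw_valid vw' /(jd_markov varA_neq0 loopd_neq0).
by rewrite -!jonesE // => /(mulfI loopd_neq0).
Qed.

Lemma jones_same_nf x y z x' y' z' :
  jones 3 (fam x y z) = jones 3 (fam x' y' z') -> same_nf x y z x' y' z'.
Proof.
rewrite (cl_jones (posw_fam _ _ _) (posw_fam _ _ _) (cl_nf_sorted x y z)).
rewrite (cl_jones (posw_fam _ _ _) (posw_fam _ _ _) (cl_nf_sorted x' y' z')).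
by apply: jones_fam_inj; lia.
Qed.

(** * Torus links in the family *)

Lemma torus3_low_braid_index n : 0 < n < 3 -> exists w, closure_eq 3 (torus3 n) 2 w.
Proof.
case: n => [|[|[|n]]] // _.
  by exists [:: s1]; apply: mk_sym; exact: mk_stab.
(* [T(3,2)] is the trefoil: its normal form [s1^3 s2] destabilizes to the 2-braid [s1^3]. *)
exists (nseq 3 s1); apply: mk_trans (cl_nf 0 0 2) _.
by apply: mk_sym; exact: (@mk_stab 2 (nseq 3 s1)).
Qed.

Theorem theorem2p23 (x1 y1 z1 x2 y2 z2 : nat) :
  (jones 3 (fam x1 y1 z1) = jones 3 (fam x2 y2 z2) ->
     closure_eq 3 (fam x1 y1 z1) 3 (fam x2 y2 z2))
  /\ (exists x y z : nat, z %% 3 = 0 /\ closure_eq 3 (fam x1 y1 z1) 3 (fam x y z))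
  /\ ((exists n : nat, 0 < n /\ closure_eq 3 (fam x1 y1 z1) 3 (torus3 n))
       /\ braid_index_three (fam x1 y1 z1) ->
      ([/\ x1 = 0, y1 = 0, 3 <= z1 & closure_eq 3 (fam x1 y1 z1) 3 (torus3 z1)] \/
          [/\ x1 = 1, y1 = 1, 2 <= z1 & closure_eq 3 (fam x1 y1 z1) 3 (torus3 (z1 + 1))] \/
          [/\ minn x1 y1 = 1, maxn x1 y1 = 3, z1 %% 3 = 0, 3 <= z1
            & closure_eq 3 (fam x1 y1 z1) 3 (torus3 (z1 + 2))] \/
          [/\ minn x1 y1 = 2, maxn x1 y1 = 4, z1 %% 3 = 2
            & closure_eq 3 (fam x1 y1 z1) 3 (torus3 (z1 + 3))] \/
          [/\ x1 = 2, y1 = 2, z1 %% 3 = 2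
            & closure_eq 3 (fam x1 y1 z1) 3 (torus3 (z1 + 2))] \/
          [/\ minn x1 y1 = 0, maxn x1 y1 = 2, z1 %% 3 = 1, 4 <= z1
            & closure_eq 3 (fam x1 y1 z1) 3 (torus3 (z1 + 1))])).
Proof.
split; [|split].
- move=> /jones_same_nf[Em EM Ek]; apply: mk_trans (cl_nf_sorted x1 y1 z1) _.
  by rewrite Em EM Ek; apply: mk_sym; exact: cl_nf_sorted.
- exists (nf_x x1 y1 z1), (nf_y x1 y1 z1), (3 * nf_k x1 y1 z1); split; last exact: cl_nf.
  by rewrite modnMr.
case=> -[n [n0 Cn]] b3.
have n3 : 3 <= n.
  rewrite leqNgt; apply/negP => n3.
  have [w Cw] := @torus3_low_braid_index n (introT andP (conj n0 n3)).
  by have := b3 _ _ (mk_trans Cn Cw).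
(* [T(3,n)] is itself the member [fam 0 0 n], so equal closures have equal normal forms. *)
have [Em EM Ek] : same_nf x1 y1 z1 0 0 n 
  by apply: jones_same_nf; exact: (cl_jones (posw_fam _ _ _) (posw_fam 0 0 n) Cn).
have key : (x1 = 0 /\ y1 = 0 /\ n = z1) \/ (x1 = 1 /\ y1 = 1 /\ n = z1 + 1) \/
    (minn x1 y1 = 1 /\ maxn x1 y1 = 3 /\ z1 %% 3 = 0 /\ n = z1 + 2) \/
    (minn x1 y1 = 2 /\ maxn x1 y1 = 4 /\ z1 %% 3 = 2 /\ n = z1 + 3) \/
    (x1 = 2 /\ y1 = 2 /\ z1 %% 3 = 2 /\ n = z1 + 2) \/
    (minn x1 y1 = 0 /\ maxn x1 y1 = 2 /\ z1 %% 3 = 1 /\ n = z1 + 1).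
  move: Em EM Ek; rewrite /nf_x /nf_y /nf_k {b3 Cn}.
  have := divn_eq z1 3; have := divn_eq n 3.
  have : z1 %% 3 < 3 by rewrite ltn_mod.
  have : n %% 3 < 3 by rewrite ltn_mod.
  move: (z1 %% 3) (z1 %/ 3) (n %% 3) (n %/ 3) => r q r' q'.
  (* Linear arithmetic for each pair of residues of [n] and [z1], splitting on zero exponents where
     the normal form depends on them. *)
  case: r' => [|[|[|r']]] //= _; case: r => [|[|[|r]]] //= _ -> ->;
    try (case: x1 => [|x1]; case: y1 => [|y1] /=); lia.
(* The lower bounds on [z1] come from [3 <= n] together with the residue of [z1]. *)
case: key => [[? [? e]]|[[? [? e]]|[[? [? [? e]]]|[[? [? [? e]]]|[[? [? [? e]]]|[? [? [? e]]]]]]]];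
  rewrite e in Cn n3.
- by left; split.
- by right; left; split=> //; lia.
- by right; right; left; split=> //; lia.
- by do 3 right; left; split.
- by do 4 right; left; split.
- by do 5 right; split=> //; lia.
Qed.
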